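(* Let $S$ be a metric signature with a distinguished unary predicate symbol $U$, and let $L$ be a countable fragment of $\mathcal{L}_{\omega_1,\omega}(S)$. Let $T$ be an $L$-theory such that $T\models\forall x\,(U(x)\vee\neg U(x))$ (equivalently, in every model of $T$ the predicate $U$ takes only the values $0$ and $1$). Let $\mathcal{M}$ be a model of $T$ of type $(\kappa,\lambda)$, where $\kappa>\lambda\ge\aleph_0$. Then there is a model $\mathcal{N}$ with $\mathcal{N}\equiv_L\mathcal{M}$ and $\mathcal{N}$ of type $(\aleph_1,\aleph_0)$. Moreover, there is a model $\mathcal{M}_0$ such that $\mathcal{M}_0\preceq_L\mathcal{M}$, $\mathcal{M}_0\preceq_L\mathcal{N}$, and $V_0=\{a\in M_0: U^{\mathcal{M}_0}(a)=1\}$ is dense in $W=\{a\in N: U^{\mathcal{N}}(a)=1\}$.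
   Context: Metric structures. A metric structure $\mathcal{M}$ consists of a metric space $(M,d)$ with $d\le 1$ (not necessarily complete), together with sets of uniformly continuous functions $M^n\to M$, of uniformly continuous predicates $M^n\to[0,1]$, and of distinguished elements; $M^n$ carries the sup metric. A metric signature $S$ consists of function symbols and predicate symbols, each with an arity and a modulus of continuity $\delta:\mathbb{Q}\cap(0,1)\to\mathbb{Q}\cap(0,1)$, and constant symbols. An $S$-structure interprets each symbol respecting its modulus: $\sup_i d(a_i,b_i)<\delta(\epsilon)$ implies $d(f(\bar a),f(\bar b))\le\epsilon$ for function symbols, resp. $|P(\bar a)-P(\bar b)|\le\epsilon$ for predicate symbols. Formulas. Terms are as in first-order logic. Atomic formulas: $d(t_1,t_2)$ and $P(t_1,\dots,t_n)$ for terms $t_i$. Formulas of $\mathcal{L}_{\omega_1,\omega}(S)$ are built from atomic formulas and constants $q\in\mathbb{Q}\cap[0,1]$ by $\varphi\to\psi$, by $\sup_x\varphi$, and by $\sup_{n<\omega}\varphi_n$ when the total number of free variables in all $\varphi_n$ is finite. Truth values $\varphi^{\mathcal{M}}(\bar a)\in[0,1]$ are defined by recursion: atomic formulas and constants in the obvious way, $(\psi\to\theta)^{\mathcal M}=\min\{1-\psi^{\mathcal M}+\theta^{\mathcal M},1\}$, and $\sup_{n}$, $\sup_x$ are suprema over $n<\omega$ and over $x\in M$. $\mathcal{M}\models\varphi(\bar a)$ means $\varphi^{\mathcal M}(\bar a)=1$. Abbreviations: $\neg\varphi=(\varphi\to 0)$, with value $1-\varphi$; $\varphi\vee\psi=((\varphi\to\psi)\to\psi)$,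 the maximum; $\forall x\,\varphi=\neg\sup_x\neg\varphi$, the infimum over $x$. Fragments. A fragment of $\mathcal{L}_{\omega_1,\omega}(S)$ is a set $L$ of $\mathcal{L}_{\omega_1,\omega}(S)$-formulas that contains every atomic formula and every constant formula $q\in\mathbb{Q}\cap[0,1]$, is closed under $\sup_x$, $\to$ and $\neg$, and is closed under substituting terms for variables. An $L$-theory is a set of $L$-sentences; a model of $T$ is an $S$-structure satisfying every sentence of $T$. $\mathcal{N}\equiv_L\mathcal{M}$ means $\sigma^{\mathcal N}=\sigma^{\mathcal M}$ for all $L$-sentences $\sigma$ (so $\mathcal N$ is then also a model of $T$ when $\mathcal M$ is). $\mathcal{N}\preceq_L\mathcal{M}$ means $\mathcal{N}$ is a substructure of $\mathcal{M}$ and $\varphi^{\mathcal N}(\bar a)=\varphi^{\mathcal M}(\bar a)$ for all $L$-formulas $\varphi$ and tuples $\bar a$ from $N$. Type of a structure. For infinite cardinals $\kappa,\lambda$, an $S$-structure $\mathcal{M}$ with universe $M$ is of type $(\kappa,\lambda)$ if the density (least cardinality of a dense subset) of $M$ is $\kappa$ and the density of $\{a\in M:U^{\mathcal M}(a)=1\}$ is $\lambda$. *)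

(* Defs.v *)
From HB Require Import structures.
From mathcomp Require Import all_boot all_order all_algebra.
From mathcomp Require Import all_classical all_reals all_analysis.

Set Implicit Arguments.
Unset Strict Implicit.
Unset Printing Implicit Defensive.

Import Order.TTheory GRing.Theory Num.Theory.
Local Open Scope classical_set_scope.
Local Open Scope card_scope.
Local Open Scope ring_scope.

(* Cardinals are represented by types: the type K stands for the cardinality
   of [set: K]. *)

Definition dense_in (X : topologicalType) (D A : set X) : Prop :=
  D `<=` A /\ A `<=` closure D.

Definition density_is (X : topologicalType) (A : set X) (K : Type) : Prop :=
  (exists2 D : set X, dense_in D A & D #= [set: K]) /\
  (forall D : set X, dense_in D A -> [set: K] #<= D).

(* K has cardinality aleph_1, the least uncountable cardinal. *)
Definition is_aleph1 (K : Type) : Prop :=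
  ~ countable [set: K] /\
  (forall K' : Type, ~ countable [set: K'] -> [set: K] #<= [set: K']).

Definition rat_oo01 := {q : rat | 0 < q < 1}.
Definition rat_cc01 := {q : rat | 0 <= q <= 1}.

Definition rat0 : rat_cc01 := exist _ 0 isT.

Record signature := Signature {
  fun_sym : Type;
  pred_sym : Type;
  const_sym : Type;
  fun_arity : fun_sym -> nat;
  pred_arity : pred_sym -> nat;
  fun_modulus : fun_sym -> rat_oo01 -> rat_oo01;
  pred_modulus : pred_sym -> rat_oo01 -> rat_oo01 }.

Section Syntax.
Variable S : signature.

(* Syntax is well scoped: [term n] and [formula n] are the terms and formulas
   whose free variables are among n variables, indexed by 'I_n. *)
Inductive term (n : nat) : Type :=
| Var of 'I_n
| Const of const_sym S
| App (f : fun_sym S) of ('I_(fun_arity f) -> term n).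

Fixpoint tsubst (n m : nat) (s : 'I_n -> term m) (t : term n) : term m :=
  match t with
  | Var i => s i
  | Const c => Const m c
  | App f ts => App (fun i => tsubst s (ts i))
  end.

(* [Sup] binds the variable ord0 of its argument; the other variables are the
   [lift ord0 i].  Since all the disjuncts of [CSup] live in the same
   [formula n], they have finitely many free variables in total. *)
Inductive formula : nat -> Type :=
| Dist n of term n & term n : formula n
| Pred n (P : pred_sym S) of ('I_(pred_arity P) -> term n) : formula n
| Cst n of rat_cc01 : formula n
| Imp n of formula n & formula n : formula n
| Sup n of formula n.+1 : formula n
| CSup n of (nat -> formula n) : formula n.

Definition Neg n (phi : formula n) : formula n := Imp phi (Cst n rat0).
Definition Or n (phi psi : formula n) : formula n := Imp (Imp phi psi) psi.
Definition All n (phi : formula n.+1) : formula n := Neg (Sup (Neg phi)).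

(* [scons x a] maps ord0 to x and [lift ord0 i] to a i. *)
Definition scons (A : Type) (n : nat) (x : A) (a : 'I_n -> A) (i : 'I_n.+1) : A :=
  oapp a x (unlift ord0 i).

Definition tshift (n : nat) : term n -> term n.+1 :=
  tsubst (fun i => Var (lift ord0 i)).

Definition slift (n m : nat) (s : 'I_n -> term m) : 'I_n.+1 -> term m.+1 :=
  scons (Var ord0) (fun i => tshift (s i)).

Fixpoint fsubst (n : nat) (phi : formula n) :
    forall m, ('I_n -> term m) -> formula m :=
  match phi in formula n return forall m, ('I_n -> term m) -> formula m with
  | Dist _ t1 t2 => fun m s => Dist (tsubst s t1) (tsubst s t2)
  | Pred _ P ts => fun m s => Pred (fun i => tsubst s (ts i))
  | Cst _ q => fun m s => Cst m q
  | Imp _ psi theta => fun m s => Imp (fsubst psi s) (fsubst theta s)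
  | Sup _ psi => fun m s => Sup (fsubst psi (slift s))
  | CSup _ psis => fun m s => CSup (fun k => fsubst (psis k) s)
  end.

(* A set of formulas is given by its formulas in n free variables, for each n.
   Closure under the supremum over an arbitrary variable follows from
   [frag_sup] and [frag_subst], which covers renamings. *)
Record is_fragment (L : forall n, set (formula n)) : Prop := IsFragment {
  frag_dist : forall n (t1 t2 : term n), L n (Dist t1 t2);
  frag_pred : forall n (P : pred_sym S) (ts : 'I_(pred_arity P) -> term n),
    L n (Pred ts);
  frag_cst : forall n (q : rat_cc01), L n (Cst n q);
  frag_sup : forall n (phi : formula n.+1), L n.+1 phi -> L n (Sup phi);
  frag_imp : forall n (phi psi : formula n),
    L n phi -> L n psi -> L n (Imp phi psi);
  frag_neg : forall n (phi : formula n), L n phi -> L n (Neg phi);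
  frag_subst : forall n m (phi : formula n) (s : 'I_n -> term m),
    L n phi -> L m (fsubst phi s) }.

Definition countable_fragment (L : forall n, set (formula n)) : Prop :=
  is_fragment L /\ countable [set p : {n & formula n} | L (tag p) (tagged p)].

End Syntax.

Section Semantics.
Variables (R : realType) (S : signature).

(* The sup metric on M^n. *)
Definition sup_dist (M : metricType R) (n : nat) (a b : 'I_n -> M) : R :=
  \big[Num.max/0]_(i < n) mdist (a i) (b i).

Record structure := Structure {
  universe :> metricType R;
  mdist_le1 : forall x y : universe, mdist x y <= 1;
  const_int : const_sym S -> universe;
  fun_int : forall f : fun_sym S, ('I_(fun_arity f) -> universe) -> universe;
  pred_int : forall P : pred_sym S, ('I_(pred_arity P) -> universe) -> R;
  pred_int_itv : forall (P : pred_sym S) (a : 'I_(pred_arity P) -> universe),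
    0 <= pred_int a <= 1;
  fun_int_modulus : forall (f : fun_sym S) (a b : 'I_(fun_arity f) -> universe)
      (e : rat_oo01),
    sup_dist a b < ratr (sval (fun_modulus f e)) ->
    mdist (fun_int a) (fun_int b) <= ratr (sval e);
  pred_int_modulus : forall (P : pred_sym S) (a b : 'I_(pred_arity P) -> universe)
      (e : rat_oo01),
    sup_dist a b < ratr (sval (pred_modulus P e)) ->
    `|pred_int a - pred_int b| <= ratr (sval e) }.

Fixpoint teval (M : structure) (n : nat) (a : 'I_n -> M) (t : term S n) : M :=
  match t with
  | Var i => a i
  | Const c => const_int M c
  | App f ts => fun_int (fun i => teval a (ts i))
  end.

Fixpoint feval (M : structure) (n : nat) (phi : formula S n) :
    ('I_n -> M) -> R :=
  match phi in formula _ n return ('I_n -> M) -> R with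
  | Dist _ t1 t2 => fun a => mdist (teval a t1) (teval a t2)
  | Pred _ P ts => fun a => pred_int (fun i => teval a (ts i))
  | Cst _ q => fun=> ratr (sval q)
  | Imp _ psi theta => fun a => Num.min (1 - feval psi a + feval theta a) 1
  | Sup _ psi => fun a => sup (range (fun x : M => feval psi (scons x a)))
  | CSup _ psis => fun a => sup (range (fun k : nat => feval (psis k) a))
  end.

Definition sentence_value (M : structure) (sigma : formula S 0) : R :=
  @feval M 0 sigma (tnth [tuple]).

Definition models (M : structure) (T : set (formula S 0)) : Prop :=
  forall sigma, T sigma -> sentence_value M sigma = 1.

Definition entails (T : set (formula S 0)) (sigma : formula S 0) : Prop :=
  forall M : structure, models M T -> sentence_value M sigma = 1.

Definition L_equiv (L : forall n, set (formula S n)) (N M : structure) : Prop :=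
  forall sigma, L 0%N sigma -> sentence_value N sigma = sentence_value M sigma.

(* [N] is a substructure of [M] along the inclusion [h]. *)
Record substructure_map (N M : structure) (h : N -> M) : Prop :=
  SubstructureMap {
  sub_dist : forall x y, mdist (h x) (h y) = mdist x y;
  sub_const : forall c : const_sym S, h (const_int N c) = const_int M c;
  sub_fun : forall (f : fun_sym S) (a : 'I_(fun_arity f) -> N),
    h (fun_int a) = fun_int (h \o a);
  sub_pred : forall (P : pred_sym S) (a : 'I_(pred_arity P) -> N),
    pred_int (h \o a) = pred_int a }.

(* [N] is an L-elementary substructure of [M] along the inclusion [h]. *)
Definition L_elementary (L : forall n, set (formula S n)) (N M : structure)
    (h : N -> M) : Prop :=
  substructure_map h /\
  (forall n (phi : formula S n) (a : 'I_n -> N),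
     L n phi -> feval phi a = feval phi (h \o a)).

(* Used for symbols [U] of arity 1, so that [fun=> a] is the 1-tuple a. *)
Definition true_set (U : pred_sym S) (M : structure) : set M :=
  [set a | @pred_int M U (fun=> a) = 1].
Arguments true_set U M _ : clear implicits.

Definition pred_var0 (U : pred_sym S) : formula S 1 :=
  @Pred S 1 U (fun=> Var S ord0).

Definition of_type (U : pred_sym S) (M : structure) (K Lam : Type) : Prop :=
  density_is [set: M] K /\ density_is (true_set U M) Lam.

End Semantics.
Arguments true_set {R S} U M _.

(* Main.v *)
Require Import Defs.
From HB Require Import structures.
From mathcomp Require Import all_boot all_order all_algebra.
From mathcomp Require Import all_classical all_reals all_analysis.
From mathcomp Require Import wochoice lra.

(* Fix a separated set A0 of more than lambda points of M, and call a set of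
   points large when it contains more than lambda points of A0. Sets that are not
   large form an ideal closed under unions of lambda many sets. M0 is a countable
   Skolem hull in M. The elements of N are the functions
   s |-> f (s k1, ..., s kn) on M^K, where |K| = aleph_1 and f ranges over a
   countable family, taken modulo limits along a filter G on M^K which is built
   by adjoining the coordinates one at a time, each one being generic for
   largeness over the previous ones. Genericity amounts to a single property:
   every lambda-valued function of the family is constant almost everywhere, and
   its value is already named in M0. With values in {0, 1} this decides formulas;
   with values in a copy of nat it selects a disjunct of a countable supremum,
   hence truth in N is the limit of truth in M; with values indexing a dense
   subset of U^M of size lambda it shows that every element of U^N is a limit of
   elements of U^M0. Distinct coordinates are distinct points of A0, so that N has
   density aleph_1. *)

Set Implicit Arguments.
Unset Strict Implicit.
Unset Printing Implicit Defensive.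

Import Order.TTheory GRing.Theory Num.Theory.
Local Open Scope classical_set_scope.
Local Open Scope card_scope.

(** * Cardinals *)

Lemma card_le_fun (T U : Type) (A : set T) (B : set U) (f : T -> U) :
  (forall x, A x -> B (f x)) ->
  (forall x y, A x -> A y -> f x = f y -> x = y) -> A #<= B.
Proof.
move=> fAB finj; have [g] : $|{injfun A >-> B}|.
  by apply/injfunPex; exists f => // x y /set_mem Ax /set_mem Ay; exact: finj.
exact: inj_card_le.
Qed.

Lemma card_le_funP (T U : Type) (u0 : U) (A : set T) (B : set U) : A #<= B ->
  exists f : T -> U, (forall x, A x -> B (f x)) /\
    (forall x y, A x -> A y -> f x = f y -> x = y).
Proof.
move=> AB; pose V := HB.pack_for pointedType U (gen_eqMixin U)
  (gen_choiceMixin U) (isPointed.Build U u0).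
have [f] := @pcard_leP T V A B AB.
exists f; split=> [x Ax|x y Ax Ay]; first exact: 'funS_f.
by apply: 'inj_f; apply/mem_set.
Qed.

Lemma card_le_surj (T U : Type) (A : set T) (B : set U) (f : U -> T) :
  A `<=` f @` B -> A #<= B.
Proof. by move=> /subset_card_le/card_le_trans; apply; exact: card_image_le. Qed.

Lemma card_leX (T T' U U' : Type) (A : set T) (B : set U) (A' : set T')
    (B' : set U') :
  A #<= A' -> B #<= B' -> A `*` B #<= A' `*` B'.
Proof.
have [[a' Aa']|/set0P/negP/negPn/eqP ->] := pselect (A' !=set0); last first.
  by rewrite card_le0 => /eqP ->; rewrite set0X.
have [[b' Bb']|/set0P/negP/negPn/eqP ->] := pselect (B' !=set0); last first.
  by rewrite card_le0 => _ /eqP ->; rewrite setX0.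
move=> /(card_le_funP a')[f [fA fi]] /(card_le_funP b')[g [gB gi]].
apply: (@card_le_fun _ _ _ _ (fun p => (f p.1, g p.2))).
  by move=> [a b] [/= Aa Bb]; split; [exact: fA|exact: gB].
move=> [a b] [c d] [/= Aa Bb] [/= Ac Bd] [fac gbd].
by rewrite (fi a c)// (gi b d).
Qed.

Lemma well_order_total (T : eqType) (R : rel T) : well_order R ->
  [/\ reflexive R, antisymmetric R, total R & transitive R].
Proof.
move=> wR; have wC : wo_chain R predT by exact: withinW.
have Rxx x : R x x by apply: (wo_chain_reflexive wC).
have Ra x y : R x y && R y x -> x = y by apply: (wo_chain_antisymmetric wC).
have Rt x y : R x y || R y x by apply: (wo_chainW wC).
split=> // y x z Rxy Ryz.
(* Transitivity: the least of the three points [x], [y], [z] is either [x], or forces [x = y] or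
   [y = z] by antisymmetry. *)
have [|w [[+ wmin] _]] := wR [pred t | [|| t == x, t == y | t == z]].
  by exists x; rewrite inE eqxx.
have := wmin x; have := wmin y; rewrite !inE !eqxx ?orbT => /(_ isT) wy /(_ isT) wx.
move=> /or3P[] /eqP ?; subst w; first by apply: wmin; rewrite inE eqxx !orbT.
  by rewrite (Ra x y) // Rxy.
by rewrite -(Ra y z) // Ryz.
Qed.

Lemma countable_setU (T : Type) (X Y : set T) :
  countable X -> countable Y -> countable (X `|` Y).
Proof.
by move=> Xc Yc; rewrite -bigcup2E; apply: bigcup_countable => // -[|[|i]] _ //=.
Qed.

(* A maximal injection between an initial segment of [T]
   and a subset of [U] exhausts [T] or [U]. *)
Lemma initial_matching (T : eqType) (U : Type) (R : rel T) : well_order R ->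
  exists g : set (T * U),
    [/\ forall x u v, g (x, u) -> g (x, v) -> u = v,
        forall x y u, g (x, u) -> g (y, u) -> x = y,
        forall x y u, g (x, u) -> R y x -> exists v, g (y, v) &
        (forall x, exists u, g (x, u)) \/ (forall u, exists x, g (x, u))].
Proof.
move=> wR; have [_ Ranti _ _] := well_order_total wR.
pose P (g : set (T * U)) :=
    [/\ forall x u v, g (x, u) -> g (x, v) -> u = v,
        forall x y u, g (x, u) -> g (y, u) -> x = y &
        forall x y u, g (x, u) -> R y x -> exists v, g (y, v)].
have [F FP totF|g [[g1 g2 g3] gmax]] := @Zorn_bigcup _ P.
  split.
  - move=> x u v [g Fg gu] [h Fh hv].
    by have [gh|hg] := totF _ _ Fg Fh;
      [have [+ _ _] := FP _ Fh|have [+ _ _] := FP _ Fg]; apply; eauto.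
  - move=> x y u [g Fg gu] [h Fh hv].
    by have [gh|hg] := totF _ _ Fg Fh;
      [have [_ + _] := FP _ Fh|have [_ + _] := FP _ Fg]; apply; eauto.
  - move=> x y u [g Fg gu] Ryx; have [_ _ /(_ _ _ _ gu Ryx)[v gv]] := FP _ Fg.
    by exists v; exists g.
exists g; split=> //; apply: contrapT => /not_orP[/existsNP[x0 gx0] /existsNP[u0 gu0]].
(* The least unmatched point [z] can be matched with the unmatched [u0]: everything strictly below
   [z] is already in the domain, so the domain remains an initial segment. *)
pose D := [pred x | `[< ~ exists u, g (x, u) >]].
have [|z [[Dz zmin] _]] := wR D; first by exists x0; apply/asboolP.
have {Dz} gz : ~ exists u, g (z, u) by move/asboolP: Dz.
apply: (gmax (g `|` [set (z, u0)])); first split.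
- by move=> p gp; left.
- by move=> /(_ (z, u0) (or_intror erefl)) gz0; apply: gz; exists u0.
split.
- move=> x u v [gu|[xz uu]] [gv|[xz' vv]]; first exact: g1 gu gv.
  + by exfalso; apply: gz; rewrite -xz'; exists u.
  + by exfalso; apply: gz; rewrite -xz; exists v.
  + by rewrite uu vv.
- move=> x y u [gu|[xz uu]] [gv|[yz uu']]; first exact: g2 gu gv.
  + by exfalso; apply: gu0; rewrite -uu'; exists x.
  + by exfalso; apply: gu0; rewrite -uu; exists y.
  + by rewrite xz yz.
- move=> x y u gxu Ryx; have [[v gv]|ngy] := pselect (exists v, g (y, v)).
    by exists v; left.
  case: gxu => [gu|[xz _]]; first by have [v] := g3 _ _ _ gu Ryx; exists v; left.
  exists u0; right; congr pair; rewrite xz in Ryx.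
  have Rzy : R z y by apply: zmin; apply/asboolP.
  by apply: Ranti; rewrite Ryx Rzy.
Qed.

Lemma card_le_total_type (T U : Type) :
  [set: T] #<= [set: U] \/ [set: U] #<= [set: T].
Proof.
have [R wR] := well_ordering_principle {classic T}.
have [g [g1 g2 _ [gT|gU]]] := initial_matching U wR; [left|right].
  have [f fP] := choice gT; apply: (@card_le_fun _ _ _ _ f) => // x y _ _ fxy.
  by apply: g2 (fP x) _; rewrite fxy; exact: fP.
have [f fP] := choice gU; apply: (@card_le_fun _ _ _ _ f) => // x y _ _ fxy.
by apply: g1 (fP x) _; rewrite fxy; exact: fP.
Qed.

Lemma card_le_total (T U : Type) (A : set T) (B : set U) : A #<= B \/ B #<= A.
Proof.
by have := card_le_total_type A B; rewrite !(card_le_eql (card_setT _))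
  !(card_le_eqr (card_setT _)).
Qed.

Lemma exists_aleph1 : exists K : Type, is_aleph1 K.
Proof.
pose T := {classic set nat}.
have Tunc : ~ countable [set: T].
  move=> /(card_le_funP 0)[f [_ fi]].
  (* Cantor's diagonal set for an injection of the power set of [nat] into [nat]. *)
  pose D := [set n | exists A : T, f A = n /\ ~ (A : set nat) n].
  have [DfD|nDfD] := pselect (D (f D)); last by apply: (nDfD); exists D.
  have [A [AD nA]] := DfD; apply: nA.
  by have -> : A = D by apply: fi.
have [R wR] := well_ordering_principle T.
(* omega_1, as the set of points with countably many predecessors *)
pose B := [set x : T | countable [set y | R y x]].
have [_ Ra Rtot _] := well_order_total wR.
have Ranti x y : R x y -> R y x -> x = y by move=> xy yx; apply: Ra; rewrite xy.
have Bunc : ~ countable B.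
  move=> Bc.
  have [nB|] := pselect (exists x, ~ B x); last first.
    move=> /forallNP allB; apply: Tunc; apply: sub_countable Bc.
    by apply: subset_card_le => x _; apply: contrapT (allB x).
  (* The least point [z] outside a countable [B] would have all its strict predecessors in [B],
     hence only countably many, and so would belong to [B]. *)
  have [|z [[+ zmin] _]] := wR [pred x | `[< ~ B x >]].
    by case: nB => x Bx; exists x; apply/asboolP.
  move=> /asboolP; apply.
  suff : countable (B `|` [set z]).
    apply: sub_countable; apply: subset_card_le => y /= Ryz.
    have [->|yz] := eqVneq y z; [by right|left].
    apply: contrapT => nBy; move/eqP: yz; apply; apply: Ranti => //.
    by apply: zmin; apply/asboolP.
  by apply: countable_setU => //; exact: countable1.
exists B; split.
  by rewrite (eq_countable (card_setT _)).
move=> K' K'unc; pose RB := [rel x y : B | R (val x) (val y)].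
have wRB : well_order RB.
  move=> A [a Aa]; have [|z [[+ zmin] _]] := wR
      [pred x | `[< exists2 b : B, b \in A & x = val b >]].
    by exists (val a); apply/asboolP; exists a.
  move=> /asboolP[b Ab zb]; exists b; split; first split=> //.
    by move=> c Ac; rewrite /RB /= -zb; apply: zmin; apply/asboolP; exists c.
  move=> c [Ac cmin]; apply: val_inj; apply: Ranti.
    by rewrite -zb; apply: zmin; apply/asboolP; exists c.
  exact: cmin.
have [g [g1 g2 g3 [gT|gU]]] := initial_matching K' wRB.
  have [f fP] := choice gT; apply: (@card_le_fun _ _ _ _ f) => // x y _ _ fxy.
  by apply: g2 (fP x) _; rewrite fxy; exact: fP.
have [f fP] := choice gU.
have finj k k' : f k = f k' -> k = k'.
  by move=> fkk; apply: g1 (fP k) _; rewrite fkk; exact: fP.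
(* The range of [f] is an initial segment of [B]. If it misses [z], it lies below [z], which has
   countably many predecessors, and [K'] would be countable. *)
have [fsurj|/existsNP[z zf]] := pselect (forall b, exists k, f k = b).
  apply: (@card_le_surj _ _ _ _ f) => b _; have [k <-] := fsurj b; by exists k.
have zmax k : RB (f k) z.
  have /orP[//|/= Rzf] := Rtot (val (f k)) (val z).
  have [k' gk'] := g3 _ _ _ (fP k) Rzf; exfalso; apply: zf; exists k'.
  by apply: g2 gk'; exact: fP.
exfalso; apply: K'unc; have /set_mem Bz := valP z.
apply: sub_countable Bz.
apply: (@card_le_fun _ _ _ _ (fun k => val (f k))) => [k _|k k' _ _ /val_inj/finj//].
exact: zmax.
Qed.

Lemma infinite_neq0 (T : Type) (A : set T) : [set: nat] #<= A -> A !=set0.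
Proof.
move=> Tinf; apply/set0P/eqP => T0; move: Tinf; rewrite T0 card_le0 => /eqP.
by move=> /seteqP[/(_ 0 I)].
Qed.

(** Tagging points by 0 or 1 embeds the union in the product of [nat] and [A], which the square of
    [A] absorbs. *)
Lemma card_leU_square (T U : Type) (A : set T) (X Y : set U) :
  [set: nat] #<= A -> A `*` A #<= A -> X #<= A -> Y #<= A -> X `|` Y #<= A.
Proof.
move=> Ainf AA XA YA.
suff XYA : X `|` Y #<= [set: nat] `*` A.
  apply: card_le_trans XYA _; apply: card_le_trans AA.
  exact: card_leX Ainf (card_lexx _).
have [[a0 Aa0]|/set0P/negP/negPn/eqP A0] := pselect (A !=set0); last first.
  by move: XA YA; rewrite A0 !card_le0 => /eqP -> /eqP ->; rewrite setU0.
have [f [fA fi]] := card_le_funP a0 XA.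
have [g [gA gi]] := card_le_funP a0 YA.
apply: (@card_le_fun _ _ _ _
  (fun u => if pselect (X u) then (0, f u) else (1, g u))) => [u Xu|u v Xu Xv].
  by case: pselect => Xu'; split=> //=; [exact: fA|apply: gA; case: Xu].
by case: pselect => Xu'; case: pselect => Xv' // [];
  [exact: fi|apply: gi; [case: Xu|case: Xv]].
Qed.

(* A maximal graph [g] of an injection [A * A -> A] with [A] infinite: if the
   complement of [A] contained a copy of [A], then [g] could be extended, so that
   [A] is equipotent to [T]. *)
Lemma card_square (T : Type) :
  [set: nat] #<= [set: T] -> [set: T * T] #<= [set: T].
Proof.
move=> Tinf.
have [t0 _] := infinite_neq0 Tinf.
pose fld (g : set (T * T * T)) := [set z | exists w, g ((z, z), w)].
pose P (g : set (T * T * T)) :=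
  [/\ (forall p w w', g (p, w) -> g (p, w') -> w = w'),
      (forall p p' w, g (p, w) -> g (p', w) -> p = p'),
      (forall p w, g (p, w) -> [/\ fld g p.1, fld g p.2 & fld g w]),
      (forall x y, fld g x -> fld g y -> exists w, g ((x, y), w)) &
      g !=set0 -> [set: nat] #<= fld g].
have fldS g h : g `<=` h -> fld g `<=` fld h.
  by move=> gh z [w gw]; exists w; exact: gh.
have [F FP totF|g [[g1 g2 g3 g4 g5] gmax]] := @Zorn_bigcup _ P.
  have two p q : (\bigcup_(X in F) X) p -> (\bigcup_(X in F) X) q ->
      exists2 g, F g & g p /\ g q.
    move=> [g Fg gp] [h Fh hq]; have [gh|hg] := totF _ _ Fg Fh.
      by exists h => //; split=> //; exact: gh.
    by exists g => //; split=> //; exact: hg.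
  have sup g : F g -> g `<=` \bigcup_(X in F) X by exact: bigcup_sup.
  split.
  - by move=> p w w' /two /[apply] -[g /FP[+ _ _ _ _] []]; apply.
  - by move=> p p' w /two /[apply] -[g /FP[_ + _ _ _] []]; apply.
  - move=> p w [g Fg gp]; have [_ _ /(_ _ _ gp)[? ? ?] _ _] := FP _ Fg.
    by split; apply: fldS (sup _ Fg) _ _.
  - move=> x y [w gx] [w' gy]; have [g Fg [gxx gyy]] := two _ _ gx gy.
    have [_ _ _ /(_ x y) + _] := FP _ Fg.
    by move=> []; [exists w|exists w'|move=> v gv; exists v; exists g].
  - move=> [p [g Fg gp]]; have [_ _ _ _ ginf] := FP _ Fg.
    apply: card_le_trans (ginf _) _; first by exists p.
    exact: subset_card_le (fldS _ _ (sup _ Fg)).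
(* The empty graph is not maximal: it extends to a pairing function on a copy of [nat] inside
   [T]. *)
have [gne|/set0P/negP/negPn/eqP g0] := pselect (g !=set0); last first.
  have [e [_ ei]] := card_le_funP t0 Tinf.
  have /andP[/(card_le_funP 0)[c [_ ci]] _] :
    ([set: nat * nat] #<= [set: nat]) && ([set: nat] #<= [set: nat * nat]).
    by rewrite -card_eq_le card_nat2.
  pose h : set (T * T * T) := [set ((e p.1, e p.2), e (c p)) | p in [set: nat * nat]].
  have fh z : fld h z <-> exists n, z = e n.
    split=> [[w [p _ [<- _ _]]]|[n ->]]; first by exists p.1.
    by exists (e (c (n, n))); exists (n, n).
  exfalso; apply: (gmax h).
    split; first by rewrite g0.
    by rewrite g0 => /(_ (e 0, e 0, e (c (0, 0)))); apply; exists (0, 0).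
  split.
  - move=> p w w' [[a b] _ [<- <-]].
    by move=> [[a' b'] _ [/ei-/(_ I I)/= -> /ei-/(_ I I)/= -> <-]].
  - move=> p p' w [[a b] _ [<- <-]] [[a' b'] _ [<- /ei-/(_ I I)/ci-/(_ I I)[-> ->]]] //.
  - move=> p w [[a b] _ [<- <-]].
    by split; apply/fh; [exists a|exists b|exists (c (a, b))].
  - move=> x y /fh[n ->] /fh[m ->]; exists (e (c (n, m))); by exists (n, m).
  - move=> _; apply: (@card_le_fun _ _ _ _ e) => [n _|n m _ _]; last exact: ei.
    by apply/fh; exists n.
set A := fld g in g3 g4 g5.
have Ainf : [set: nat] #<= A := g5 gne.
have AA : A `*` A #<= A.
  have /choice[f fP] : forall p : T * T, exists w, (A `*` A) p -> g (p, w).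
    move=> [x y]; have [[/= Ax Ay]|nA] := pselect ((A `*` A) (x, y)).
      by have [w gw] := g4 _ _ Ax Ay; exists w.
    by exists t0.
  apply: (@card_le_fun _ _ _ _ f) => [p /fP/g3[]//|p q /fP gp /fP gq fpq].
  by apply: g2 gp _; rewrite fpq.
have [CA|AC] := card_le_total (~` A) A.
  have TA : [set: T] #<= A.
    by rewrite -(setUv A); apply: card_leU_square.
  have -> : [set: T * T] = setT `*` setT by rewrite setXTT.
  apply: card_le_trans (card_leX TA TA) _.
  by apply: card_le_trans AA _; exact: subset_card_le.
have [h [hA hi]] := card_le_funP t0 AC.
pose B := A `|` h @` A.
have BA : B #<= A by apply: card_leU_square => //; exact: card_image_le.
have [k [kA ki]] := card_le_funP t0 (card_le_trans (card_leX BA BA) AA).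
(* The pairs over [B] that are not pairs over [A] get values in the image of [A] under [h]. It is
   disjoint from [A], so the extended graph stays injective. *)
pose new := [set (p, h (k p)) | p in [set p | (B `*` B) p /\ ~ (A `*` A) p]].
have Agnew : fld (g `|` new) = B.
  apply/seteqP; split=> z.
    move=> [w [gz|[p [[/= Bp _] _] [pz _]]]]; first by left; exists w.
    by rewrite pz in Bp.
  have [Az _|nAz Bz] := pselect (A z).
    by case: Az => w gw; exists w; left.
  by exists (h (k (z, z))); right; exists (z, z) => //; split=> // -[].
exfalso; apply: (gmax (g `|` new)).
  split; first by move=> p gp; left.
  have [n [An _]] : exists a, A a /\ True.
    by case: gne => -[[x y] w] /g3[/= Ax _ _]; exists x.
  have Bn : B (h n) by right; exists n.
  have nA : ~ A (h n) by exact: hA.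
  move=> /(_ ((h n, h n), h (k (h n, h n)))) gn; apply: (nA).
  have /g3[//] : g ((h n, h n), h (k (h n, h n))).
  by apply: gn; right; exists (h n, h n) => //; split=> // -[] /nA.
have hkA p : (B `*` B) p -> ~ A (h (k p)) by move=> /kA/hA.
split; rewrite ?Agnew.
- move=> p w w' [gp|[q [Bq nAq] [qp qw]]] [gp'|[q' [Bq' nAq'] [qp' qw']]].
  + exact: g1 gp gp'.
  + by exfalso; apply: nAq'; rewrite qp'; have [] := g3 _ _ gp.
  + by exfalso; apply: nAq; rewrite qp; have [] := g3 _ _ gp'.
  + by rewrite -qw -qw' qp qp'.
- move=> p p' w [gp|[q [Bq nAq] [qp qw]]] [gp'|[q' [Bq' nAq'] [qp' qw']]].
  + exact: g2 gp gp'.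
  + by exfalso; apply: (hkA _ Bq'); rewrite qw'; have [] := g3 _ _ gp.
  + by exfalso; apply: (hkA _ Bq); rewrite qw; have [] := g3 _ _ gp'.
  + rewrite -qp -qp'; apply: ki => //; apply: hi; [exact: kA|exact: kA|].
    by rewrite qw qw'.
- move=> p w [/g3[? ? ?]|[q [[Bq Bq'] _] [<- <-]]]; first by split; left.
  by split=> //; right; exists (k q) => //; exact: kA.
- move=> x y Bx By; have [[/= Ax Ay]|nA] := pselect ((A `*` A) (x, y)).
    by have [w gw] := g4 _ _ Ax Ay; exists w; left.
  by exists (h (k (x, y))); right; exists (x, y).
- by move=> _; apply: card_le_trans Ainf _; apply: subset_card_le; left.
Qed.

(** A list is coded by iterated pairing. Its length is recorded separately, because the folded code
    alone does not tell where the list ends. *)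
Lemma card_le_seq (T : Type) :
  [set: nat] #<= [set: T] -> [set: seq T] #<= [set: T].
Proof.
move=> Tinf; have TT := card_square Tinf.
have [t0 _] := infinite_neq0 Tinf.
have [f [_ fi]] := card_le_funP t0 TT.
have [e [_ ei]] := card_le_funP t0 Tinf.
pose code := foldr (fun x y => f (x, y)) t0.
apply: (@card_le_fun _ _ _ _ (fun s => f (e (size s), code s))) => // s s' _ _.
move=> /(fi _ _ I I)[/(ei _ _ I I)].
elim: s s' => [|x s ih] [|y s'] //= [/ih{}ih] /(fi _ _ I I)[-> /ih ->//].
Qed.

Lemma card_le_surjP (T U : Type) (u0 : U) (A : set T) :
  A !=set0 -> A #<= [set: U] ->
  exists f : U -> T, (forall u, A (f u)) /\ A `<=` range f.
Proof.
move=> [a Aa] /(card_le_funP u0)[g [_ ginj]].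
have /choice[f fP] : forall u, exists x, A x /\ ((exists2 y, A y & g y = u) -> g x = u).
  move=> u; have [[y Ay gy]|ny] := pselect (exists2 y, A y & g y = u).
    by exists y.
  by exists a; split=> // /ny.
exists f; split=> [u|x Ax]; first by have [] := fP u.
exists (g x) => //; have [Af] := fP (g x) => /(_ (ex_intro2 _ _ x Ax erefl)).
exact: ginj.
Qed.

Lemma countable_image (T U : Type) (f : T -> U) (A : set T) :
  countable A -> countable (f @` A).
Proof. by apply: sub_countable; exact: card_image_le. Qed.

Lemma countable_reachable (T : Type) (A : set T) (next : T -> set T) :
  countable A -> (forall x, countable (next x)) ->
  exists B, [/\ A `<=` B, countable B & forall x, B x -> next x `<=` B].
Proof.
move=> Ac nextc; pose lvl := fix lvl n := if n is n.+1 then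
  \bigcup_(x in lvl n) next x else A.
exists (\bigcup_n lvl n); split.
- by move=> x Ax; exists 0%N.
- apply: bigcup_countable => // n _; elim: n => [//|n ih] /=.
  exact: bigcup_countable.
- by move=> x [n _ xn] y xy; exists n.+1 => //; exists x.
Qed.

Lemma countable_seq_set (T : eqType) (A : set T) : countable A ->
  countable [set s : seq T | forall x, x \in s -> A x].
Proof.
move=> Ac; have [A0|/set0P/negP/negPn/eqP ->] := pselect (A !=set0); last first.
  apply: sub_countable (countable1 [::]); apply: subset_card_le => -[//|x s] /=.
  by move=> /(_ x (mem_head _ _)).
have [f [_ fA]] := card_le_surjP 0 A0 Ac.
apply: sub_countable (@countableP (seq nat) setT).
apply: (@card_le_surj _ _ _ _ (map f)) => s; elim: s => [_|x s ih sA].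
  by exists [::].
have [|t _ <-] := ih; first by move=> y ys; apply: sA; rewrite inE ys orbT.
by have [n _ <-] := fA _ (sA x (mem_head _ _)); exists (n :: t).
Qed.

(** The levels of the closure increase, so the finitely many arguments of an operation lie in a
    common level. Operations take a whole sequence, so that one type covers all arities. *)
Lemma countable_closure (T : eqType) (O : set (seq T -> T)) : countable O ->
  exists C : set T, countable C /\
    forall g s, O g -> (forall x, x \in s -> C x) -> C (g s).
Proof.
move=> Oc; pose lvl := fix lvl n : set T := if n is n.+1 then
  [set g s | g in O & s in [set s | forall x, x \in s -> lvl n x]] else set0.
have lvlS n : lvl n `<=` lvl n.+1.
  elim: n => [//|n ih] _ [g Og [s sl <-]]; exists g => //; exists s => //.
  by move=> x /sl/ih.
have lvl_le n m : n <= m -> lvl n `<=` lvl m.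
  move=> nm; rewrite -(subnK nm); elim: (m - n) => [//|k ih].
  by rewrite addSn => x /ih/lvlS.
have lvlc n : countable (lvl n).
  elim: n => [|n ih] /=; first exact: countable0.
  have -> : [set g s | g in O & s in [set s | forall x, x \in s -> lvl n x]]
     = (fun p => p.1 p.2) @` (O `*` [set s | forall x, x \in s -> lvl n x]).
    apply/seteqP; split=> [_ [g Og [s sl <-]]|_ [[g s] [/= Og sl] <-]].
      by exists (g, s).
    by exists g => //; exists s.
  by apply: countable_image; apply: countableX => //; exact: countable_seq_set.
exists (\bigcup_n lvl n); split; first exact: bigcup_countable.
move=> g s Og sC; suff [n sn] : exists n, forall x, x \in s -> lvl n x.
  by exists n.+1 => //; exists g => //; exists s.
elim: s sC => [_|x s ih sC]; first by exists 0.
have [|n sn] := ih; first by move=> y ys; apply: sC; rewrite inE ys orbT.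
have [m _ xm] := sC x (mem_head _ _).
exists (maxn n m) => y; rewrite inE => /orP[/eqP ->|ys].
  by apply: lvl_le xm; exact: leq_maxr.
by apply: lvl_le (sn _ ys); exact: leq_maxl.
Qed.

(** * Generic filters *)

Section Large.
Variables (X : choiceType) (Lam : Type) (A0 : set X).
Hypothesis Lam_inf : [set: nat] #<= [set: Lam].
Hypothesis A0_big : ~ (A0 #<= [set: Lam]).

Definition large (A : set X) := ~ (A0 `&` A #<= [set: Lam]).

Lemma large_sub (A B : set X) : A0 `&` A `<=` B -> large A -> large B.
Proof.
move=> AB lA lB; apply: lA; apply: card_le_trans lB; apply: subset_card_le.
by move=> x [? ?]; split=> //; exact: AB.
Qed.

Lemma large_setT : large setT.
Proof. by rewrite /large setIT. Qed.

(** If no cell were large inside [A], a point of [A0] in [A] would be coded by the index of its cell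
    together with its code within that cell, that is, by a pair from [Lam]; and the square of [Lam]
    is no larger than [Lam]. *)
Lemma large_bigcup (A : set X) (B : Lam -> set X) :
  (forall x, A x -> exists c, B c x) -> large A ->
  exists c, large (A `&` B c).
Proof.
move=> AB lA; apply: contrapT => /forallNP nl; apply: lA.
have [c0 _] := infinite_neq0 Lam_inf.
apply: card_le_trans (card_square Lam_inf).
have {nl} /choice[f fP] : forall c, exists f : X -> Lam,
    forall x y, (A0 `&` (A `&` B c)) x -> (A0 `&` (A `&` B c)) y -> f x = f y -> x = y.
  by move=> c; have /contrapT/(card_le_funP c0)[f [_ fi]] := nl c; exists f.
have /choice[g gP] : forall x, exists c, A x -> B c x.
  move=> x; have [/AB[c Bc]|nA] := pselect (A x); first by exists c.
  by exists c0.
apply: (@card_le_fun _ _ _ _ (fun x => (g x, f (g x) x))) => //.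
move=> x y [Ax Bx] [Ay By] [gxy]; rewrite gxy; apply: fP; split=> //; split=> //.
  by rewrite -gxy; exact: gP.
exact: gP.
Qed.

Lemma large_neq0 (A : set X) : large A -> (A0 `&` A) !=set0.
Proof.
by move=> lA; apply/set0P/eqP => A00; apply: lA; rewrite A00; exact: card_ge0.
Qed.

Lemma large_setD (A : set X) (s : seq X) : large A -> large (A `\` [set` s]).
Proof.
move=> lA; have [c0 [c1 c01]] : exists c0 c1 : Lam, c0 <> c1.
  have [c _] := infinite_neq0 Lam_inf.
  have [e [_ ei]] := card_le_funP c Lam_inf; exists (e 0), (e 1).
  by move=> /ei-/(_ I I).
(* The cell of [c0] is the complement of [s]. Every other cell is [s] itself, which is finite and
   therefore not large. *)
have [x _|c] := large_bigcup
    (B := fun c => [set x | c = c0 <-> x \notin s]) _ lA.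
  have [xs|xs] := boolP (x \in s); last by exists c0.
  by exists c1; split=> [/esym/c01//|]; rewrite xs.
have [-> |cc0] := pselect (c = c0).
  by apply: large_sub => x [_ [? [/(_ erefl) /negP ?]]].
move=> lS; exfalso; apply: lS; apply: card_le_trans Lam_inf.
apply: (@card_le_trans _ _ _ [set` s]).
  apply: subset_card_le => x [_ [_ [_ xs]]] /=.
  by apply/negPn/negP => /xs.
by apply: finite_set_countable; exact: finite_seq.
Qed.

End Large.

(** Lets a function of the coordinates [e] be read as a function of the coordinates of a larger list
    [f], through positions that do not depend on [s]. *)
Lemma map_reindex (X : Type) (K : eqType) (x0 : X) (s : K -> X) (e f : seq K) :
  {subset e <= f} ->
  [seq nth x0 (map s f) i | i <- map (index^~ f) e] = map s e.
Proof.
move=> ef; rewrite -map_comp; apply/eq_in_map => k /ef kf /=.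
by rewrite (nth_map k) ?index_mem// nth_index.
Qed.

Section Generic.
Variables (X K : choiceType) (x0 : X) (Lam : Type) (A0 : set X).
Hypothesis Lam_inf : [set: nat] #<= [set: Lam].
Hypothesis A0_big : ~ (A0 #<= [set: Lam]).
Local Notation large := (large Lam A0).

Variables (top : Lam) (C : set (seq X -> Lam)).

Definition supported (J : set K) (Z : set (K -> X)) :=
  forall s s', (forall k, J k -> s k = s' k) -> Z s -> Z s'.

Definition holds (G : set (set (K -> X))) (P : set (K -> X)) :=
  exists2 Z, G Z & Z `<=` P.

(* [G] is a filter base whose members only constrain the coordinates in [J].
   [gen_const] is the genericity; [mu [::]] is a value of the family [C] that
   depends on no coordinate. *)
Record generic (J : set K) (G : set (set (K -> X))) : Prop := Generic {
  gen_supp : forall Z, G Z -> supported J Z;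
  gen_dir : forall Z Z', G Z -> G Z' -> exists2 Z'', G Z'' & Z'' `<=` Z `&` Z';
  gen_neq0 : forall Z, G Z -> Z !=set0;
  gen_ne : G !=set0;
  gen_const : forall nu e, C nu -> (forall k, k \in e -> J k) ->
    exists2 mu, C mu & holds G [set s | nu (map s e) = mu [::]];
  gen_A0 : forall k, J k -> holds G [set s | A0 (s k)];
  gen_inj : forall k k', J k -> J k' -> k <> k' -> holds G [set s | s k <> s k'] }.

Hypothesis C_top : C (fun=> top).
Hypothesis C_reindex : forall nu (ks : seq nat), C nu ->
  C (fun v => nu [seq nth x0 v k | k <- ks]).
(* [y] codes the condition [y v = top]. *)
Hypothesis C_choose : forall y nu, C y -> C nu -> exists2 g, C g & forall v,
  (exists c, large [set x | y (rcons v x) = top /\ nu (rcons v x) = c]) ->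
  large [set x | y (rcons v x) = top /\ nu (rcons v x) = g v].
Hypothesis C_and : forall y nu mu, C y -> C nu -> C mu -> exists2 p, C p &
  forall v, p v = top <-> y v = top /\ nu v = mu [::].

Lemma holds_and J G P Q : generic J G -> holds G P -> holds G Q ->
  holds G (P `&` Q).
Proof.
move=> gG [Z GZ ZP] [W GW WQ]; have [V GV VZW] := gen_dir gG GZ GW.
by exists V => // s /VZW[/ZP ? /WQ].
Qed.

Lemma holds_sub G P Q : P `<=` Q -> holds G P -> holds G Q.
Proof. by move=> PQ [Z GZ ZP]; exists Z => // s /ZP/PQ. Qed.

Lemma holds_neq0 J G P : generic J G -> holds G P -> P !=set0.
Proof. by move=> gG [Z /(gen_neq0 gG)[s Zs] ZP]; exists s; exact: ZP. Qed.

Hypothesis C_countable : countable C.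

Section Step.
Variables (J : set K) (G : set (set (K -> X))) (a : K).
Hypotheses (gG : generic J G) (Ja : ~ J a).

Let upd (s : K -> X) x k := if k == a then x else s k.

Let updJ s x k : J k -> upd s x k = s k.
Proof. by move=> Jk; rewrite /upd; case: eqP => // ka; rewrite ka in Jk. Qed.

Let map_upd s x e : (forall k, k \in e -> J k) ->
  map (upd s x) (rcons e a) = rcons (map s e) x.
Proof.
move=> eJ; rewrite map_rcons {2}/upd eqxx; congr rcons.
by apply/eq_in_map => k /eJ; exact: updJ.
Qed.

(* A condition [t] for the new coordinate [a] is kept if, for almost all [s],
   it holds for a large set of values of [a]. *)
Let positive (t : (seq X -> Lam) * seq K) :=
  [/\ C t.1, (forall k, k \in t.2 -> J k) &
      holds G [set s | large [set x | t.1 (rcons (map s t.2) x) = top]]].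

(** For almost all [s], the large set of values of [a] allowed by [t] splits according to the value
    of [nu], and [large_bigcup] keeps one piece large. [C_choose] selects such a value as a function
    of the old coordinates, and genericity over [J] makes the selected value constant almost
    everywhere. Adding this value to the condition preserves positivity. *)
Let positive_decide t nu e : positive t -> C nu ->
  (forall k, k \in e -> J k \/ k = a) ->
  exists t' mu, [/\ positive t', C mu & forall s,
    t'.1 (map s (rcons t'.2 a)) = top ->
    t.1 (map s (rcons t.2 a)) = top /\ nu (map s e) = mu [::]].
Proof.
case: t => y e0 [/= Cy e0J ypos] Cnu eJ.
(* [E] lists the old coordinates on which the condition or [nu] depends. The new one comes last, so
   that both become functions of [rcons (map s E) x]. *)
pose E := e0 ++ [seq k <- e | k != a]; pose F := rcons E a.
have EJ k : k \in E -> J k.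
  by rewrite mem_cat mem_filter => /orP[/e0J//|/andP[/eqP ka /eJ[]]].
have e0F : {subset rcons e0 a <= F}.
  by move=> k; rewrite !mem_rcons !inE mem_cat => /orP[->//|->]; rewrite orbT.
have eF : {subset e <= F}.
  move=> k ke; rewrite mem_rcons inE mem_cat mem_filter ke andbT.
  by case: eqP; rewrite ?orbT.
have Cy' := C_reindex (map (index^~ F) (rcons e0 a)) Cy.
have Cnu' := C_reindex (map (index^~ F) e) Cnu.
have [g Cg gP] := C_choose Cy' Cnu'.
have [mu Cmu gmu] := gen_const gG Cg EJ.
have [p Cp pP] := C_and Cy' Cnu' Cmu.
exists (p, E), mu; split=> //; last first.
  by move=> s /= /pP; rewrite !map_reindex.
split=> //=; have := holds_and gG ypos gmu; apply: holds_sub => s [/= yl gs].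
have {gP} := gP (map s E); rewrite gs => gP.
apply: large_sub (gP _); first by move=> x [_ Px]; exact: (proj2 (pP _) Px).
have [x _|c] := large_bigcup Lam_inf (B := fun c => [set x |
    nu [seq nth x0 (rcons (map s E) x) k | k <- map (index^~ F) e] = c]) _ yl.
  by eexists.
move=> lc; exists c; apply: large_sub lc => x [_ [/= ys cs]].
split=> //; rewrite -(map_upd s x EJ) map_reindex// map_upd//.
Qed.

(** There are countably many functions of the family applied to finite lists of coordinates from the
    enlarged set. A decreasing sequence of positive conditions decides them one after another,
    starting from the trivial condition, and the new filter base combines these conditions with the
    members of [G]. *)
Lemma generic_step : countable J -> exists2 G', generic (J `|` [set a]) G' &
  forall Z, G Z -> holds G' Z.
Proof.
move=> Jc; pose Ja' := J `|` [set a].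
have Ja'c : countable Ja'.
  by apply: countable_setU => //; exact: countable1.
pose task : set ((seq X -> Lam) * seq K) :=
  C `*` [set e | forall k, k \in e -> Ja' k].
have task0 : task !=set0 by exists (fun=> top, [::]).
have task_c : countable task by apply: countableX => //; exact: countable_seq_set.
have [f [fT Tf]] := card_le_surjP 0 task0 task_c.
have pos0 : positive (fun=> top, [::]).
  split=> //=; have [Z GZ] := gen_ne gG; exists Z => // s _ /=.
  by apply: large_sub (large_setT A0_big) => x.
have /choice[next nextP] : forall p : {t | positive t} * nat,
    exists t' : {t | positive t}, exists mu, C mu /\ forall s,
    (sval t').1 (map s (rcons (sval t').2 a)) = top ->
    (sval p.1).1 (map s (rcons (sval p.1).2 a)) = top /\
    (f p.2).1 (map s (f p.2).2) = mu [::].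
  move=> [[t tpos] n] /=; have [Cn eJ] := fT n.
  have [t' [mu [t'pos Cmu H]]] := positive_decide tpos Cn eJ.
  by exists (exist _ t' t'pos), mu.
pose st := fix st n := if n is n.+1 then next (st n, n) else exist _ _ pos0.
pose Y n := [set s | (sval (st n)).1 (map s (rcons (sval (st n)).2 a)) = top].
have Y_le n m : n <= m -> Y m `<=` Y n.
  move=> nm; rewrite -(subnK nm); elim: (m - n) => [//|k ih] s.
  by have [mu [_ H]] := nextP (st (k + n), k + n); rewrite addSn => /H[/ih].
(* Largeness leaves room for these requirements, which put the new coordinate in [A0] and keep it
   apart from the old ones. *)
pose D (l : seq K) := [set s : K -> X | A0 (s a) /\ forall k, k \in l -> s a <> s k].
pose G' : set (set (K -> X)) := [set W | exists n Z l,
  [/\ G Z, (forall k, k \in l -> J k) & W = Y n `&` Z `&` D l]].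
have G'I n Z l : G Z -> (forall k, k \in l -> J k) -> G' (Y n `&` Z `&` D l).
  by move=> GZ lJ; exists n, Z, l.
have [Z0 GZ0] := gen_ne gG.
have lift P : holds G P -> holds G' P.
  move=> [Z GZ ZP]; exists (Y 0 `&` Z `&` D [::]); first exact: G'I.
  by move=> s [[_ /ZP]].
exists G'; last by move=> Z GZ; apply: lift; exists Z.
split.
- move=> _ [n [Z [l [GZ lJ ->]]]] s s' ss' [[Ys Zs] [A0s Ds]].
  have ssJ k : J k -> s k = s' k by move=> Jk; apply: ss'; left.
  have ssa : s a = s' a by apply: ss'; right.
  split; last first.
    split=> [|k kl]; rewrite -ssa//.
    by rewrite -(ssJ _ (lJ _ kl)); exact: Ds.
  split; last exact: (gen_supp gG GZ ssJ Zs).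
  suff ss'e : map s (rcons (sval (st n)).2 a) = map s' (rcons (sval (st n)).2 a).
    by rewrite /Y/= -ss'e.
  apply/eq_in_map => k; have [_ eJ _] := svalP (st n).
  by rewrite mem_rcons inE => /orP[/eqP ->|/eJ/ssJ].
- move=> _ _ [n [Z [l [GZ lJ ->]]]] [m [W [r [GW rJ ->]]]].
  have [V GV VZW] := gen_dir gG GZ GW.
  exists (Y (maxn n m) `&` V `&` D (l ++ r)).
    by apply: G'I => // k; rewrite mem_cat => /orP[/lJ|/rJ].
  move=> s [[Ys /VZW[Zs Ws]] [A0s Ds]]; split; split=> //.
  + by split=> //; apply: Y_le Ys; exact: leq_maxl.
  + by split=> // k kl; apply: Ds; rewrite mem_cat kl.
  + by split=> //; apply: Y_le Ys; exact: leq_maxr.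
  + by split=> // k kl; apply: Ds; rewrite mem_cat kl orbT.
(* Some [s] in [Z] admits a large set of values for [a]. Removing the finitely many values of [s] on
   [l] leaves a point of [A0] to put at [a], and [Z] does not notice the change because it
   constrains only [J]. *)
- move=> _ [n [Z [l [GZ lJ ->]]]]; have [_ eJ pos] := svalP (st n).
  have GZ' : holds G Z by exists Z.
  have [s [/= sl Zs]] := holds_neq0 gG (holds_and gG pos GZ').
  have /large_neq0[x [A0x [xY /= xl]]] := large_setD (s := map s l) Lam_inf sl.
  exists (upd s x); split; first split.
  + by rewrite /Y/= map_upd.
  + by apply: (gen_supp gG GZ _ Zs) => k Jk; rewrite updJ.
  + split=> [|k kl]; first by rewrite /upd eqxx.
    rewrite (updJ s x (lJ _ kl)) /upd eqxx => xk; apply: xl.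
    by rewrite xk; apply: map_f.
- by exists (Y 0 `&` Z0 `&` D [::]); exact: G'I.
- move=> nu e Cnu eJ; have [n _ fn] := Tf (nu, e) (conj Cnu eJ).
  have [mu [Cmu H]] := nextP (st n, n); exists mu => //.
  exists (Y n.+1 `&` Z0 `&` D [::]); first exact: G'I.
  by move=> s [[/H[_]]]; rewrite fn.
- move=> k [Jk|->]; first by apply: lift; exact: (gen_A0 gG Jk).
  by exists (Y 0 `&` Z0 `&` D [::]); [exact: G'I|move=> s [_ []]].
- have Da k : J k -> holds G' [set s | s a <> s k].
    move=> Jk; exists (Y 0 `&` Z0 `&` D [:: k]).
      by apply: G'I => // k'; rewrite inE => /eqP ->.
    by move=> s [_ [_]]; apply; rewrite inE.
  move=> k k' [Jk|->] [Jk'|->] kk'; last by case: kk'.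
  + by apply: lift; exact: (gen_inj gG Jk Jk' kk').
  + by have := Da k Jk; apply: holds_sub => s sk /esym.
  + exact: Da.
Qed.

End Step.

(* A countable [J] can be enlarged by [generic_step], so that a maximal one is
   uncountable. *)
Lemma exists_generic : ~ countable [set: K] ->
  exists J G, ~ countable J /\ generic J G.
Proof.
move=> Kunc.
pose T := {p : set K * set (set (K -> X)) | generic p.1 p.2}.
pose t0 : set K * set (set (K -> X)) := (set0, [set setT]).
have gen0 : generic t0.1 t0.2.
  split=> //=.
  - by move=> Z ->.
  - by move=> Z Z' -> ->; exists setT => //; rewrite setTI.
  - by move=> Z ->; exists (fun=> x0).
  - by exists setT.
  - move=> nu [|k e] Cnu eJ; last by have := eJ k (mem_head _ _).
    by exists nu => //; exists setT.
pose mk p (g : generic p.1 p.2) : T := exist _ p g.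
(* The order compares the generated filters: [generic_step] refines the members of the old base
   instead of keeping them. *)
pose R (p q : T) := `[< (sval p).1 `<=` (sval q).1 /\
  forall Z, (sval p).2 Z -> holds (sval q).2 Z >].
have [||A Atot|[[J G] /= gG] Gmax] := @ZL_preorder T (mk _ gen0) R.
- by move=> p; apply/asboolP; split=> // Z pZ; exists Z.
- move=> q p r /asboolP[pq pqG] /asboolP[qr qrG]; apply/asboolP.
  split=> [k /pq/qr//|Z /pqG[W /qrG[V rV VW] WZ]].
  by exists V => // s /VW/WZ.
- have [[p0 Ap0]|/set0P/negP/negPn/eqP ->] := pselect (A !=set0); last first.
    by exists (mk _ gen0).
  pose J := \bigcup_(p in A) (sval p).1; pose G := \bigcup_(p in A) (sval p).2.
  have two p q : A p -> A q -> exists2 r, A r & R p r /\ R q r.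
    have Rxx r : R r r by apply/asboolP; split=> // Z rZ; exists Z.
    move=> Ap Aq; have [pq|qp] := Atot _ _ Ap Aq.
      by exists q.
    by exists p.
  have sub p P : A p -> holds (sval p).2 P -> holds G P.
    by move=> Ap [Z pZ ZP]; exists Z => //; exists p.
  have gU : generic (J : set K, G).1 (J : set K, G).2.
    split=> /=.
    + move=> Z [p Ap pZ] s s' ss'; apply: (gen_supp (svalP p) pZ) => k Jk.
      by apply: ss'; exists p.
    + move=> Z Z' [p Ap pZ] [q Aq qZ'].
      have [r Ar [/asboolP[_ /(_ _ pZ) rZ] /asboolP[_ /(_ _ qZ') rZ']]] :=
        two _ _ Ap Aq.
      have [V rV VZ] := holds_and (svalP r) rZ rZ'.
      by exists V => //; exists r.
    + by move=> Z [p Ap pZ]; exact: (gen_neq0 (svalP p) pZ).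
    + by have [Z pZ] := gen_ne (svalP p0); exists Z; exists p0.
    + move=> nu e Cnu eJ.
      (* A finite list of coordinates is already contained in the coordinate set of one member of
         the chain, whose genericity then applies. *)
      suff [p Ap pe] : exists2 p, A p & forall k, k \in e -> (sval p).1 k.
        have [mu Cmu H] := gen_const (svalP p) Cnu pe.
        by exists mu => //; exact: sub H.
      elim: e eJ => [|k e ih] eJ; first by exists p0.
      have [|p Ap pe] := ih; first by move=> k' k'e; apply: eJ; rewrite inE k'e orbT.
      have [q Aq qk] := eJ k (mem_head _ _).
      have [r Ar [/asboolP[pr _] /asboolP[qr _]]] := two _ _ Ap Aq.
      by exists r => // k'; rewrite inE => /orP[/eqP ->|/pe/pr//]; exact: qr.
    + by move=> k [p Ap pk]; apply: (sub p) => //; exact: (gen_A0 (svalP p) pk).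
    + move=> k k' [p Ap pk] [q Aq qk'] kk'.
      have [r Ar [/asboolP[pr _] /asboolP[qr _]]] := two _ _ Ap Aq.
      by apply: (sub r) => //; exact: (gen_inj (svalP r) (pr _ pk) (qr _ qk') kk').
  exists (mk (J, G) gU) => p Ap; apply/asboolP; split=> /= [k pk|Z pZ].
    by exists p.
  by exists Z => //; exists p.
exists J, G; split=> // Jc.
have [a Ja] : exists a, ~ J a.
  apply: contrapT => /forallNP JT; apply: Kunc; apply: sub_countable Jc.
  by apply: subset_card_le => k _; apply: contrapT (JT k).
have [G' gG' GG'] := generic_step gG Ja Jc.
have /Gmax/asboolP[/= /(_ a)] : R (mk (J, G) gG) (mk (J `|` [set a], G') gG').
  by apply/asboolP; split=> //= k Jk; left.
by move=> /(_ (or_intror erefl)).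
Qed.
End Generic.

Local Open Scope ring_scope.

(** * Metric quotients and limits along a filter *)

(** Points of [E] at distance 0 are identified, each class being stored as a subset of [T]. As [d]
    is a pseudometric on [E] only, [cls] sends points outside [E] to the class of [t0] by
    default. *)
Lemma metric_quotient (R : realType) (T : Type) (E : set T) (d : T -> T -> R) :
  E !=set0 ->
  (forall x, E x -> d x x = 0) ->
  (forall x y, E x -> E y -> d x y = d y x) ->
  (forall y x z, E x -> E y -> E z -> d x z <= d x y + d y z) ->
  exists (N : metricType R) (cls : T -> N) (rep : N -> T),
    [/\ forall n, E (rep n), forall n, cls (rep n) = n &
        forall x y, E x -> E y -> mdist (cls x) (cls y) = d x y].
Proof.
move=> [t0 Et0] dxx dC dtri.
have dge0 x y : E x -> E y -> 0 <= d x y.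
  by move=> Ex Ey; have := dtri y x x Ex Ey Ex; rewrite dxx// (dC y x)//; lra.
pose same x := [set y | E y /\ d x y = 0].
have same_eq x y : E x -> E y -> d x y = 0 -> same x = same y.
  have sub a b : E a -> E b -> d a b = 0 -> same a `<=` same b.
    move=> Ea Eb ab z [Ez az]; split=> //; apply/eqP; rewrite eq_le dge0// andbT.
    by have := dtri a b z Eb Ea Ez; rewrite az (dC b a)// ab addr0.
  by move=> Ex Ey xy; apply/seteqP; split; apply: sub => //; rewrite dC.
pose Q := {c : set T | exists2 x, E x & c = same x}.
have Qeq (a b : Q) : sval a = sval b -> a = b.
  by case: a b => [a ?] [b ?] /=; exact: eq_exist.
have same_ex c : exists x, (exists2 x, E x & c = same x) -> E x /\ c = same x.
  have [[x Ex cx]|nc] := pselect (exists2 x, E x & c = same x).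
    by exists x.
  by exists t0 => /nc.
have [r rP] := choice same_ex.
pose rep (c : Q) := r (sval c).
have repE c : E (rep c) by have [] := rP _ (svalP c).
have repS c : sval c = same (rep c) by have [] := rP _ (svalP c).
have sameE x : exists2 y, E y & (if pselect (E x) then same x else same t0) = same y.
  by case: pselect => Ex; [exists x|exists t0].
pose cls x : Q := exist _ _ (sameE x).
have clsE x : E x -> sval (cls x) = same x by move=> Ex /=; case: pselect.
have cls0 x : E x -> d (rep (cls x)) x = 0.
  move=> Ex; have := repS (cls x); rewrite clsE// => /seteqP[+ _].
  by move=> /(_ x (conj Ex (dxx _ Ex)))[].
have clsrep c : cls (rep c) = c.
  by apply: Qeq; rewrite clsE.
pose dQ (a b : Q) := d (rep a) (rep b).
have dQxx a : dQ a a = 0 by exact: dxx.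
have dQ0 a b : dQ a b = 0 -> a = b.
  by move=> ab; apply: Qeq; rewrite (repS a) (repS b); exact: same_eq.
have dQC a b : dQ a b = dQ b a by exact: dC.
have dQtri b a c : dQ a c <= dQ a b + dQ b c by exact: dtri.
pose N0 := HB.pack_for choiceType Q (gen_eqMixin Q) (gen_choiceMixin Q).
pose N := HB.pack_for (metricType R) Q N0 (isMetric.Build R N0 dQxx dQ0 dQC dQtri).
exists N, cls, rep; split=> // x y Ex Ey; change (dQ (cls x) (cls y) = d x y).
have dE a b c : E a -> E b -> E c -> d a b = 0 -> d a c = d b c.
  move=> Ea Eb Ec ab; have := dtri b a c Ea Eb Ec; have := dtri a b c Eb Ea Ec.
  by rewrite (dC b a)// ab !add0r => ? ?; apply/eqP; rewrite eq_le; apply/andP.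
rewrite /dQ (dE _ x)// ?cls0//; first by rewrite dC// (dE _ y) ?cls0 // dC.
Qed.

Section Limits.
Context (R : realType) (T : Type) (F : set_system T) {FF : ProperFilter F}.
Implicit Types (X Y : T -> R).

Definition tends X (r : R) := forall e, 0 < e -> \forall s \near F, `|X s - r| < e.

Lemma tends_le X Y x y : tends X x -> tends Y y ->
  (\forall s \near F, X s <= Y s) -> x <= y.
Proof.
move=> Xx Yy XY; rewrite leNgt; apply/negP => yx.
have e0 : 0 < (x - y) / 2 by lra.
have [s [[Xs Ys] XYs]] := filter_ex (filterI (filterI (Xx _ e0) (Yy _ e0)) XY).
by move: Xs Ys XYs; rewrite !ltr_distl => /andP[? _] /andP[_ ?] ?; lra.
Qed.

Lemma tends_cst (c : R) : tends (fun=> c) c.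
Proof. by move=> e e0; near=> s; rewrite subrr normr0. Unshelve. all: by end_near. Qed.

Lemma tends_unique X x y : tends X x -> tends X y -> x = y.
Proof.
move=> Xx Xy; apply/eqP; rewrite eq_le; apply/andP.
by split; [apply: (tends_le Xx Xy)|apply: (tends_le Xy Xx)]; exact: nearW.
Qed.

Lemma tends_lt X x c : tends X x -> x < c -> \forall s \near F, X s < c.
Proof.
move=> Xx xc; have e0 : 0 < c - x by lra.
by apply: filterS (Xx _ e0) => s; rewrite ltr_distl => /andP[_]; lra.
Qed.

Lemma tends_gt X x c : tends X x -> c < x -> \forall s \near F, c < X s.
Proof.
move=> Xx xc; have e0 : 0 < x - c by lra.
by apply: filterS (Xx _ e0) => s; rewrite ltr_distl => /andP[+ _]; lra.
Qed.

Lemma tends_lipschitz X Y (f : R -> R -> R) x y :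
  (forall a b a' b', `|f a b - f a' b'| <= `|a - a'| + `|b - b'|) ->
  tends X x -> tends Y y -> tends (fun s => f (X s) (Y s)) (f x y).
Proof.
move=> fL Xx Yy e e0; have e20 : 0 < e / 2 by lra.
apply: filterS (filterI (Xx _ e20) (Yy _ e20)) => s [Xs Ys].
by apply: le_lt_trans (fL _ _ _ _) _; lra.
Qed.

(** The limit is the Dedekind cut formed by the rationals that [X] exceeds almost everywhere; a
    rational above the cut is almost everywhere not exceeded. *)
Lemma tends_decided X : (forall s, 0 <= X s <= 1) ->
  (forall q : rat, F [set s | ratr q < X s] \/ F [set s | ~ (ratr q < X s)]) ->
  exists x, tends X x.
Proof.
move=> X01 dec;
pose A := [set x : R | exists2 q : rat, x = ratr q & F [set s | x < X s]].
(* A number strictly below all values of [X] is wanted, and 0 may be attained. *)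
have Am : A (ratr (-1)%Q).
  exists (-1)%Q => //; apply: nearW => s /=; rewrite rmorphN1.
  by have /andP[+ _] := X01 s; lra.
have A1 : ubound A 1.
  move=> x [q _ FX]; have [s /= Xs] := filter_ex FX.
  by have /andP[_] := X01 s; lra.
have Aub : has_ubound A by exists 1.
exists (sup A) => e e0.
have [x [q xq Fx] xs] := @sup_gt _ A (sup A - e) (ex_intro _ _ Am) (ltac:(lra)).
have [p] := @rat_in_itvoo R (sup A) (sup A + e) (ltac:(lra)).
rewrite in_itv/= => /andP[sp pe].
have Fp : F [set s | ~ (ratr p < X s)].
  case: (dec p) => // Fp; suff : ratr p <= sup A by lra.
  by apply: ub_le_sup => //; exists p.
apply: filterS (filterI Fx Fp) => s [/= xX /negP]; rewrite -leNgt => Xp.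
by rewrite ltr_distl; lra.
Qed.

End Limits.

Section Values.
Variables (R : realType) (S : signature) (M : structure R S).

Lemma sup_itv (A : set R) : A !=set0 -> (forall x, A x -> 0 <= x <= 1) ->
  0 <= sup A <= 1.
Proof.
move=> A0 A01; have Aub : has_ubound A by exists 1 => x /A01/andP[].
apply/andP; split; last by apply: ge_sup => // x /A01/andP[].
have [x Ax] := A0; have /andP[x0 _] := A01 x Ax.
by apply: le_trans x0 _; exact: ub_le_sup.
Qed.

Hypothesis M0 : [set: M] !=set0.

Lemma feval_itv n (phi : formula S n) (a : 'I_n -> M) : 0 <= feval phi a <= 1.
Proof.
elim: phi a => {n} [n t1 t2|n P ts|n q|n phi ih psi ih'|n phi ih|n phi ih] a /=.
- by rewrite mdist_ge0 mdist_le1.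
- exact: pred_int_itv.
- by have /andP[q0 q1] := svalP q; rewrite ler0q q0 /= -(ler_rat R) rmorph1 in q1 *.
- have := ih a; have := ih' a => /andP[? ?] /andP[? ?].
  rewrite le_min ge_min; apply/andP; split; [apply/andP; split|apply/orP; right];
    lra.
- by apply: sup_itv => [|_ [x _ <-]//]; have [x _] := M0; eexists; exists x.
- by apply: sup_itv => [|_ [x _ <-]//]; eexists; exists 0%N.
Qed.

End Values.

(** * Reduced powers *)

Lemma scons0 (A : Type) n (x : A) (a : 'I_n -> A) : scons x a ord0 = x.
Proof. by rewrite /scons unlift_none. Qed.

Lemma sconsS (A : Type) n (x : A) (a : 'I_n -> A) i : scons x a (lift ord0 i) = a i.
Proof. by rewrite /scons liftK. Qed.

Lemma map_scons (A B : Type) (f : A -> B) n (x : A) (a : 'I_n -> A) :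
  (fun i => f (scons x a i)) = scons (f x) (fun i => f (a i)).
Proof.
apply/funext => i; have [j ->|->] := unliftP ord0 i.
  by rewrite !sconsS.
by rewrite !scons0.
Qed.

(** A fragment need not contain the subformulas of its members, whereas the induction identifying
    truth in a power with a limit of truth values descends to them. *)
Record subformula_closed (S : signature) (L : forall n, set (formula S n)) : Prop :=
  SubformulaClosed {
  sfc_dist : forall n (t1 t2 : term S n), L n (Dist t1 t2);
  sfc_pred : forall n (P : pred_sym S) (ts : 'I_(pred_arity P) -> term S n),
    L n (Pred ts);
  sfc_impl : forall n (phi psi : formula S n), L n (Imp phi psi) -> L n phi;
  sfc_impr : forall n (phi psi : formula S n), L n (Imp phi psi) -> L n psi;
  sfc_sup : forall n (phi : formula S n.+1), L n (Sup phi) -> L n.+1 phi;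
  sfc_csup : forall n (phi : nat -> formula S n) k, L n (CSup phi) -> L n (phi k) }.

Section GenericPower.
Variables (R : realType) (S : signature) (M : structure R S).
Context (Om : Type) (F : set_system Om) {FF : ProperFilter F}.
Variables (E : set (Om -> M)) (L : forall n, set (formula S n)).
Hypothesis L_closed : subformula_closed L.
Hypothesis E0 : E !=set0.
Hypothesis E_term : forall n (t : term S n) (x : 'I_n -> Om -> M),
  (forall i, E (x i)) -> E (fun s => teval (fun i => x i s) t).
Hypothesis E_sup : forall n (phi : formula S n.+1) (x : 'I_n -> Om -> M) (q : rat),
  L (Sup phi) -> (forall i, E (x i)) -> exists2 y, E y & forall s,
    (exists z, ratr q < feval phi (scons z (fun i => x i s))) ->
    ratr q < feval phi (scons (y s) (fun i => x i s)).
Hypothesis F_dec : forall n (phi : formula S n) (x : 'I_n -> Om -> M) (q : rat),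
  L phi -> (forall i, E (x i)) ->
  F [set s | ratr q < feval phi (fun i => x i s)] \/
  F [set s | ~ (ratr q < feval phi (fun i => x i s))].
Hypothesis F_csup : forall n (phi : nat -> formula S n) (x : 'I_n -> Om -> M) (q : rat),
  L (CSup phi) -> (forall i, E (x i)) ->
  F [set s | exists k, ratr q < feval (phi k) (fun i => x i s)] ->
  exists k, F [set s | ratr q < feval (phi k) (fun i => x i s)].

Let M_neq0 : [set: M] !=set0.
Proof.
by have [x _] := E0; have [s _] := filter_ex (@filterT _ F _); exists (x s).
Qed.

Let feval_tends n (phi : formula S n) (x : 'I_n -> Om -> M) :
  L phi -> (forall i, E (x i)) ->
  exists r, tends F (fun s => feval phi (fun i => x i s)) r.
Proof.
move=> Lphi Ex; apply: tends_decided => [s|q]; first exact: feval_itv.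
exact: F_dec.
Qed.

Let dist (x y : Om -> M) : R :=
  xget 0 [set r | tends F (fun s => mdist (x s) (y s)) r].

Let dist_tends x y : E x -> E y -> tends F (fun s => mdist (x s) (y s)) (dist x y).
Proof.
move=> Ex Ey; have [|i|r Hr] := @feval_tends 2
  (Dist (Var S ord0) (Var S (lift ord0 ord0))) (scons x (fun=> y)).
- exact: sfc_dist.
- by have [j ->|->] := unliftP ord0 i; rewrite ?sconsS ?scons0.
apply: (@xgetPex _ 0 [set r | tends F (fun s => mdist (x s) (y s)) r]); exists r.
by move: Hr; rewrite /= scons0 sconsS.
Qed.

(** A form of Łoś's theorem in which the filter need only decide the formulas of [L] at points of
    [E]. The universe is [E] modulo limit distance 0. In the induction, the Skolem functions of
    [E_sup] handle suprema over the universe, and [F_csup] handles countable suprema. *)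
Lemma generic_power : exists (N : structure R S) (cls : (Om -> M) -> N),
  (forall b, exists2 x, E x & cls x = b) /\
  forall n (phi : formula S n) (x : 'I_n -> Om -> M),
    L phi -> (forall i, E (x i)) ->
    tends F (fun s => feval phi (fun i => x i s)) (feval phi (fun i => cls (x i))).
Proof.
have [|x Ex|x y Ex Ey|y x z Ex Ey Ez|N0 [cls [rep [repE clsrep mdistE]]]] :=
  @metric_quotient R (Om -> M) E dist => //.
- apply: (tends_unique (dist_tends Ex Ex)) => e e0; near=> s.
  by rewrite mdistxx subrr normr0.
- apply: (tends_unique (dist_tends Ex Ey)).
  by have := dist_tends Ey Ex; under eq_fun do rewrite metric_sym.
- have addL (a b a' b' : R) : `|a + b - (a' + b')| <= `|a - a'| + `|b - b'|.
    by rewrite opprD addrACA; exact: ler_normD.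
  apply: (tends_le (dist_tends Ex Ez)).
    exact: (tends_lipschitz addL (dist_tends Ex Ey) (dist_tends Ey Ez)).
  by apply: nearW => s; exact: metric_triangle.
have dist0 x : E x -> dist (rep (cls x)) x = 0.
  by move=> Ex; rewrite -mdistE// clsrep mdistxx.
have near_lt n (x y : 'I_n -> Om -> M) (d : R) : 0 < d ->
    (forall i, E (x i)) -> (forall i, E (y i)) ->
    (forall i, dist (x i) (y i) < d) ->
    F [set s | sup_dist (fun i => x i s) (fun i => y i s) < d].
  move=> d0 Ex Ey xy.
  have : F [set s | forall i, mdist (x i s) (y i s) < d].
    by apply: filter_forall => i; apply: tends_lt (xy i); exact: dist_tends.
  by apply: filterS => s xys; apply: bigmax_lt => // i _; exact: xys.
have ratr_gt0 (d : rat_oo01) : 0 < ratr (sval d) :> R.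
  by have /andP[d0 _] := svalP d; rewrite ltr0q.
(* Moduli speak of rationals in the open unit interval only. Representatives at distance 0 meet
   every modulus, so the results differ by less than every such rational; this shows below that
   interpretations do not depend on representatives. *)
have ratr_small (r : R) : 0 <= r -> (forall e : rat_oo01, r <= ratr (sval e)) -> r = 0.
  move=> r0 re; apply/eqP; rewrite eq_le r0 andbT leNgt; apply/negP => r_gt0.
  have [q] := @rat_in_itvoo R 0 (Num.min r 1) (ltac:(by rewrite lt_min r_gt0 ltr01)).
  rewrite in_itv/= lt_min ltr0q => /and3P[q0 qr].
  rewrite -[X in _ < X -> _](rmorph1 (@ratr R)) ltr_rat => q1.
  have q01 : 0 < q < 1 by rewrite q0.
  by have := re (exist _ q q01) => /=; lra.
have E_fun f (x : 'I_(fun_arity f) -> Om -> M) : (forall i, E (x i)) ->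
    E (fun s => fun_int (fun i => x i s)).
  by move=> Ex; exact: (@E_term _ (App (fun i => Var S i)) x).
have fun_mod f (x y : 'I_(fun_arity f) -> Om -> M) (e : rat_oo01) :
    (forall i, E (x i)) -> (forall i, E (y i)) ->
    (forall i, dist (x i) (y i) < ratr (sval (fun_modulus f e))) ->
    dist (fun s => fun_int (fun i => x i s)) (fun s => fun_int (fun i => y i s))
      <= ratr (sval e).
  move=> Ex Ey xy.
  have H := dist_tends (E_fun _ _ Ex) (E_fun _ _ Ey).
  apply: (tends_le H (@tends_cst _ _ F _ (ratr (sval e)))).
  apply: filterS (near_lt _ _ _ _ _ Ex Ey xy) => // s; exact: fun_int_modulus.
pose pint P (x : 'I_(pred_arity P) -> Om -> M) : R :=
  xget 0 [set r | tends F (fun s => pred_int (fun i => x i s)) r].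
have pintP P x : (forall i, E (x i)) ->
    tends F (fun s => pred_int (fun i => x i s)) (@pint P x).
  move=> Ex; have [|r Hr] := @feval_tends _ (Pred (fun i => Var S i)) x _ Ex.
    exact: sfc_pred.
  apply: (@xgetPex _ 0 [set r | tends F (fun s => pred_int (fun i => x i s)) r]).
  by exists r.
have pred_mod P (x y : 'I_(pred_arity P) -> Om -> M) (e : rat_oo01) :
    (forall i, E (x i)) -> (forall i, E (y i)) ->
    (forall i, dist (x i) (y i) < ratr (sval (pred_modulus P e))) ->
    `|pint P x - pint P y| <= ratr (sval e).
  move=> Ex Ey xy.
  have subL (a b a' b' : R) : `| `|a - b| - `|a' - b'| | <= `|a - a'| + `|b - b'|.
    apply: le_trans (ler_dist_dist _ _) _; rewrite opprD addrACA.
    by apply: le_trans (ler_normD _ _) _; rewrite -opprD normrN.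
  apply: tends_le (tends_lipschitz subL (pintP P x Ex) (pintP P y Ey))
    (@tends_cst _ _ F _ (ratr (sval e))) _.
  apply: filterS (near_lt _ _ _ _ _ Ex Ey xy) => // s; exact: pred_int_modulus.
have mdist_rep a b : mdist a b = dist (rep a) (rep b).
  by rewrite -mdistE// !clsrep.
have sup_distP n (a b : 'I_n -> N0) (d : R) : sup_dist a b < d ->
    forall i, dist (rep (a i)) (rep (b i)) < d.
  by move=> abd i; rewrite -mdist_rep; apply: le_lt_trans abd; exact: le_bigmax.
have le1 (a b : N0) : mdist a b <= 1.
  rewrite mdist_rep.
  apply: (tends_le (dist_tends (repE a) (repE b)) (@tends_cst _ _ F _ 1)).
  by apply: nearW => s; exact: mdist_le1.
have pint01 P (a : 'I_(pred_arity P) -> N0) : 0 <= @pint P (rep \o a) <= 1.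
  have H := pintP P _ (fun i => repE (a i)).
  apply/andP; split; [apply: (tends_le (@tends_cst _ _ F _ 0) H)|
    apply: (tends_le H (@tends_cst _ _ F _ 1))];
    by apply: nearW => s; have /andP[] := pred_int_itv (fun i => rep (a i) s).
pose fint f (a : 'I_(fun_arity f) -> N0) :=
  cls (fun s => fun_int (fun i => rep (a i) s)).
have fint_mod f (a b : 'I_(fun_arity f) -> N0) (e : rat_oo01) :
    sup_dist a b < ratr (sval (fun_modulus f e)) ->
    mdist (fint f a) (fint f b) <= ratr (sval e).
  by move=> /sup_distP ab; rewrite mdistE; [apply: fun_mod|apply: E_fun|apply: E_fun].
have pint_mod P (a b : 'I_(pred_arity P) -> N0) (e : rat_oo01) :
    sup_dist a b < ratr (sval (pred_modulus P e)) ->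
    `|pint P (rep \o a) - pint P (rep \o b)| <= ratr (sval e).
  by move=> /sup_distP ab; apply: pred_mod => [i|i|];
    [exact: repE|exact: repE|exact: ab].
pose N := @Structure R S N0 le1 (fun c => cls (fun=> const_int M c)) fint
  (fun P a => pint P (rep \o a)) pint01 fint_mod pint_mod.
have fun_cls f (x : 'I_(fun_arity f) -> Om -> M) : (forall i, E (x i)) ->
    fint f (fun i => cls (x i)) = cls (fun s => fun_int (fun i => x i s)).
  move=> Ex; apply: mdist_positivity; rewrite mdistE; [|exact: E_fun|exact: E_fun].
  apply: ratr_small => [|e].
    by rewrite -mdistE ?mdist_ge0//; exact: E_fun.
  by apply: fun_mod => // i; rewrite dist0.
have pred_cls P (x : 'I_(pred_arity P) -> Om -> M) : (forall i, E (x i)) ->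
    pint P (rep \o (fun i => cls (x i))) = pint P x.
  move=> Ex; apply/eqP; rewrite -subr_eq0 -normr_eq0; apply/eqP.
  apply: ratr_small => // e; apply: pred_mod => [i|//|i]; first exact: repE.
  by rewrite /= dist0.
have teval_cls n (t : term S n) (x : 'I_n -> Om -> M) : (forall i, E (x i)) ->
    @teval R S N n (fun i => cls (x i)) t = cls (fun s => teval (fun i => x i s) t).
  move=> Ex; elim: t => [i|c|f ts ih] //=.
  have -> : (fun i => @teval R S N n (fun i => cls (x i)) (ts i)) =
      (fun i => cls (fun s => teval (fun i => x i s) (ts i))) by exact/funext.
  by rewrite fun_cls// => i; exact: E_term.
exists N, cls; split=> [b|]; first by exists (rep b).
have M01 n (phi : formula S n) a := @feval_itv R S M M_neq0 n phi a.
have N_neq0 : [set: N] !=set0 by have [x _] := E0; exists (cls x).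
have N01 n (phi : formula S n) (a : 'I_n -> N) := @feval_itv R S N N_neq0 n phi a.
have ratr_le (r t : R) : (forall q : rat, ratr q < r -> ratr q <= t) -> r <= t.
  move=> rt; rewrite leNgt; apply/negP => tr; have [q] := rat_in_itvoo tr.
  by rewrite in_itv/= => /andP[tq /rt]; lra.
move=> n phi; elim: phi => {n}
  [n t1 t2|n P ts|n q|n phi ih psi ih'|n phi ih|n phi ih] x Lphi Ex.
- by rewrite /= !teval_cls// mdistE; [apply: dist_tends|..]; exact: E_term.
- rewrite /=.
  have -> : (fun i => @teval R S N n (fun i => cls (x i)) (ts i)) =
      (fun i => cls (fun s => teval (fun i => x i s) (ts i))).
    by apply/funext => i; exact: teval_cls.
  by rewrite pred_cls; [apply: pintP|]; move=> i; exact: E_term.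
- exact: tends_cst.
- apply: (tends_lipschitz _ (ih x (sfc_impl L_closed Lphi) Ex)
    (ih' x (sfc_impr L_closed Lphi) Ex) (f := fun a b => Num.min (1 - a + b) 1)).
  move=> a b a' b'; rewrite ler_norml.
  have := ler_norm (a - a'); have := ler_norm (- (a - a')).
  have := ler_norm (b - b'); have := ler_norm (- (b - b')); rewrite !normrN.
  move=> ? ? ? ?; case: (lerP (1 - a + b) 1) => ?;
    case: (lerP (1 - a' + b') 1) => ?; apply/andP; split; lra.
- have [r Hr] := feval_tends Lphi Ex.
  have Lphi' := sfc_sup L_closed Lphi.
  have Escons y i : E y -> E (scons y x i).
    by move=> Ey; have [j ->|->] := unliftP ord0 i; rewrite ?sconsS ?scons0.
  have ihy y : E y -> tends F (fun s => feval phi (scons (y s) (fun i => x i s)))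
      (@feval R S N _ phi (scons (cls y) (fun i => cls (x i)))).
    move=> Ey; have := ih (scons y x) Lphi' (Escons y ^~ Ey).
    rewrite (map_scons cls).
    by under eq_fun do rewrite (map_scons (fun z => z _)).
  have subM s z :
      feval phi (scons z (fun i => x i s)) <= feval (Sup phi) (fun i => x i s).
    apply: ub_le_sup; last by exists z.
    by exists 1 => _ [w _ <-]; have /andP[] := M01 _ phi (scons w (fun i => x i s)).
  suff -> : @feval R S N n (Sup phi) (fun i => cls (x i)) = r by [].
  apply/eqP; rewrite eq_le; apply/andP; split.
    apply: ge_sup; first by have [y _] := E0; eexists; exists (cls y).
    move=> _ [b _ <-]; rewrite -(clsrep b).
    by apply: (tends_le (ihy _ (repE b)) Hr); apply: nearW => s; exact: subM.
  (* [r] is the limit of the suprema in [M]. For [q] below [r] the witness [y] keeps the value above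
     [q] almost everywhere, and the class of [y] transfers this bound to the supremum in [N]. *)
  apply: ratr_le => q qr; have [y Ey yP] := E_sup q Lphi Ex.
  apply: (@le_trans _ _ (@feval R S N _ phi (scons (cls y) (fun i => cls (x i)))));
    last first.
    apply: ub_le_sup; last by exists (cls y).
    by exists 1 => _ [w _ <-]; have /andP[] := N01 _ phi (scons w (fun i => cls (x i))).
  apply: (tends_le (@tends_cst _ _ F _ (ratr q)) (ihy y Ey)).
  apply: filterS (tends_gt Hr qr) => s qs; apply/ltW/yP.
  have [|_ [z _ <-] zq] := sup_gt _ qs; last by exists z.
  by have [z _] := M_neq0; eexists; exists z.
- have [r Hr] := feval_tends Lphi Ex.
  have ihk k := ih k x (sfc_csup L_closed k Lphi) Ex.
  suff -> : @feval R S N n (CSup phi) (fun i => cls (x i)) = r by [].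
  apply/eqP; rewrite eq_le; apply/andP; split.
    apply: ge_sup; first by eexists; exists 0%N.
    move=> _ [k _ <-]; apply: (tends_le (ihk k) Hr); apply: nearW => s.
    apply: ub_le_sup; last by exists k.
    by exists 1 => _ [w _ <-]; have /andP[] := M01 _ (phi w) (fun i => x i s).
  apply: ratr_le => q qr.
  have [|k kP] := @F_csup n phi x q Lphi Ex.
    apply: filterS (tends_gt Hr qr) => s qs.
    have [|_ [k _ <-] kq] := sup_gt _ qs; last by exists k.
    by eexists; exists 0%N.
  apply: (@le_trans _ _ (@feval R S N _ (phi k) (fun i => cls (x i)))); last first.
    apply: ub_le_sup; last by exists k.
    by exists 1 => _ [w _ <-]; have /andP[] := N01 _ (phi w) (fun i => cls (x i)).
  apply: (tends_le (@tends_cst _ _ F _ (ratr q)) (ihk k)).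
  by apply: filterS kP => s /ltW.
Unshelve. all: by end_near.
Qed.

End GenericPower.

(** * Skolem functions *)

Section Fragments.
Variable S : signature.

Definition immediate (p : {n & formula S n}) : set {n & formula S n} :=
  match tagged p with
  | Imp _ phi psi => [set Tagged (formula S) phi; Tagged (formula S) psi]
  | Sup _ phi => [set Tagged (formula S) phi]
  | CSup _ phi => range (fun k => Tagged (formula S) (phi k))
  | _ => set0
  end.

Lemma countable_subformulas (L : forall n, set (formula S n)) :
  countable_fragment L -> exists L' : forall n, set (formula S n),
  [/\ forall n, L n `<=` L' n, subformula_closed L' &
      countable [set p : {n & formula S n} | L' (tag p) (tagged p)]].
Proof.
move=> [Lf Lc]; have [|B [LB Bc Bi]] := countable_reachable (next := immediate) Lc.
  move=> [n [{}n t1 t2|{}n P ts|{}n q|{}n phi psi|{}n phi|{}n phi]] /=;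
    rewrite /immediate/=.
  - exact: countable0.
  - exact: countable0.
  - exact: countable0.
  - exact: finite_set_countable.
  - exact: countable1.
  - by apply: countable_image; exact: countableP.
exists (fun n => [set phi | B (Tagged (formula S) phi)]); split=> [n phi||].
- exact: LB (Tagged _ phi).
- split=> /= [n t1 t2|n P ts|n phi psi Bp|n phi psi Bp|n phi Bp|n phi k Bp].
  + by apply: LB; exact: frag_dist.
  + by apply: LB; exact: frag_pred.
  + by apply: Bi Bp _ _; left.
  + by apply: Bi Bp _ _; right.
  + exact: Bi Bp _ _.
  + by apply: Bi Bp _ _; exists k.
- by apply: sub_countable Bc; apply: subset_card_le => -[].
Qed.

(** A term [t] is recovered from the atomic formula [Dist t t], which lies in [L]; on other formulas
    the inverse [g] takes a default value. *)
Lemma countable_terms (L : forall n, set (formula S n)) :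
  subformula_closed L ->
  countable [set p : {n & formula S n} | L (tag p) (tagged p)] ->
  countable [set: {n & term S n}].
Proof.
move=> Lsf; apply: sub_countable.
pose f (p : {n & term S n}) := Tagged (formula S) (Dist (tagged p) (tagged p)).
pose g (p : {n & formula S n}) : {n & term S n} :=
  match tagged p with
  | Dist _ t _ => Tagged (term S) t
  | Pred n _ _ | Cst n _ | Imp n _ _ | Sup n _ | CSup n _ =>
    Tagged (term S) (Var S (@ord0 n))
  end.
have gf p : g (f p) = p by case: p.
apply: (@card_le_fun _ _ _ _ f) => [[n t] _|p q _ _ fpq].
  exact: sfc_dist.
by rewrite -(gf p) fpq gf.
Qed.

End Fragments.

Section Skolem.
Variables (R : realType) (S : signature) (M : structure R S).
Variables (L : forall n, set (formula S n)) (Lam : choiceType).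
Variables (x0 : M) (u : nat -> M) (A0 : set M).
Variables (top bot : Lam) (inj : nat -> Lam) (dmap : Lam -> M).

(* [FM] and [FL] consist of functions of the coordinates listed in a sequence;
   [A0], [top] and [dmap] play the roles of the separated set, of the truth value
   of conditions and of an enumeration of a dense subset of the true set. *)
Record rich (FM : set (seq M -> M)) (FL : set (seq M -> Lam)) : Prop := Rich {
  rich_coord : forall k, FM (fun v => nth x0 v k);
  rich_u : forall k, FM (fun=> u k);
  rich_term : forall n (t : term S n) (g : 'I_n -> seq M -> M),
    (forall i, FM (g i)) -> FM (fun v => teval (fun i => g i v) t);
  rich_sup : forall n (phi : formula S n.+1) (g : 'I_n -> seq M -> M) (q : rat),
    L (Sup phi) -> (forall i, FM (g i)) -> exists2 y, FM y & forall v,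
      (exists z, ratr q < feval phi (scons z (fun i => g i v))) ->
      ratr q < feval phi (scons (y v) (fun i => g i v));
  rich_dmap : forall nu, FL nu -> FM (fun v => dmap (nu v));
  rich_reM : forall f (ks : seq nat), FM f ->
    FM (fun v => f [seq nth x0 v k | k <- ks]);
  rich_reL : forall f (ks : seq nat), FL f ->
    FL (fun v => f [seq nth x0 v k | k <- ks]);
  rich_top : FL (fun=> top);
  rich_choose : forall y nu, FL y -> FL nu -> exists2 g, FL g & forall v,
    (exists c, large Lam A0 [set x | y (rcons v x) = top /\ nu (rcons v x) = c]) ->
    large Lam A0 [set x | y (rcons v x) = top /\ nu (rcons v x) = g v];
  rich_and : forall y nu mu, FL y -> FL nu -> FL mu -> exists2 p, FL p &
    forall v, p v = top <-> y v = top /\ nu v = mu [::];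
  rich_near : forall k f, FM f -> exists2 nu, FL nu & forall v,
    (exists c, mdist (f v) (dmap c) < k.+1%:R^-1) ->
    mdist (f v) (dmap (nu v)) < k.+1%:R^-1;
  rich_atom : forall n (phi : formula S n) (g : 'I_n -> seq M -> M) (q : rat),
    L phi -> (forall i, FM (g i)) -> exists2 nu, FL nu &
      forall v, nu v = top <-> ratr q < feval phi (fun i => g i v);
  rich_csup : forall n (phi : nat -> formula S n) (g : 'I_n -> seq M -> M) (q : rat),
    L (CSup phi) -> (forall i, FM (g i)) -> exists2 nu, FL nu & forall v,
      (exists k, ratr q < feval (phi k) (fun i => g i v)) ->
      exists k, nu v = inj k /\ ratr q < feval (phi k) (fun i => g i v) }.

Hypothesis top_bot : top <> bot.
Hypothesis L_closed : subformula_closed L.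
Hypothesis L_countable : countable [set p : {n & formula S n} | L (tagged p)].

(** The two families refer to each other, so they are generated together, as the two projections of
    one countable set of pairs closed under countably many operations. An operation that concerns
    one family fills the other component with a constant. *)
Lemma exists_rich : exists FM FL, [/\ countable FM, countable FL & rich FM FL].
Proof.
pose A : eqType := ((seq M -> M) * (seq M -> Lam))%type.
pose a0 : A := (fun=> x0, fun=> top).
pose arg (l : seq A) (v : seq M) n (i : 'I_n) : M := (nth a0 l i).1 v.
pose opM (f : seq M -> M) : A := (f, fun=> top).
pose opL (f : seq M -> Lam) : A := (fun=> x0, f).
pose o_coord k (l : seq A) := opM (fun v => nth x0 v k).
pose o_u k (l : seq A) := opM (fun=> u k).
pose o_term (p : {n & term S n}) (l : seq A) :=
  opM (fun v => teval (@arg l v (tag p)) (tagged p)).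
pose o_dmap (l : seq A) := opM (fun v => dmap ((nth a0 l 0).2 v)).
pose o_re ks (l : seq A) : A :=
  (fun v => (nth a0 l 0).1 [seq nth x0 v k | k <- ks],
   fun v => (nth a0 l 0).2 [seq nth x0 v k | k <- ks]).
pose o_choose (l : seq A) := opL (fun v => xget top [set c |
  large Lam A0 [set x | (nth a0 l 0).2 (rcons v x) = top /\
    (nth a0 l 1).2 (rcons v x) = c]]).
pose o_and (l : seq A) := opL (fun v =>
  if `[< (nth a0 l 0).2 v = top /\ (nth a0 l 1).2 v = (nth a0 l 2).2 [::] >]
  then top else bot).
pose o_near k (l : seq A) := opL (fun v => xget top [set c |
  mdist ((nth a0 l 0).1 v) (dmap c) < k.+1%:R^-1]).
pose o_atom (p : {n & formula S n} * rat) (l : seq A) := opL (fun v =>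
  if ratr p.2 < feval (tagged p.1) (@arg l v (tag p.1)) then top else bot).
(* One operation supplies witnesses for both kinds of suprema; on any other formula it returns the
   default [a0]. *)
pose o_wit (p : {n & formula S n} * rat) (l : seq A) : A :=
  match tagged p.1 with
  | Sup n phi => opM (fun v => xget x0 [set z |
      ratr p.2 < feval phi (scons z (@arg l v n))])
  | CSup n phi => opL (fun v => xget top [set c |
      exists k, c = inj k /\ ratr p.2 < feval (phi k) (@arg l v n)])
  | _ => a0
  end.
pose LQ : set ({n & formula S n} * rat) :=
  [set p | L (tagged p)] `*` setT.
have LQc : countable LQ by apply: countableX => //; exact: countableP.
pose O : set (seq A -> A) := (range o_coord `|` range o_u `|` range o_term)
  `|` ([set o_dmap] `|` range o_re `|` [set o_choose] `|` [set o_and])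
  `|` (range o_near `|` (o_atom @` LQ) `|` (o_wit @` LQ)).
have rng (T : countType) (f : T -> seq A -> A) : countable (range f).
  by apply: countable_image; exact: countableP.
have Oc : countable O.
  have tc := countable_terms L_closed L_countable.
  rewrite /O; repeat apply: countable_setU; first [exact: rng|exact: countable1
    |exact: (countable_image _ tc)|exact: (countable_image _ LQc)].
have [Cl [Clc ClO]] := countable_closure Oc.
pose FM := fst @` Cl; pose FL := snd @` Cl.
have FMo o l : O o -> (forall a, a \in l -> Cl a) -> FM (o l).1.
  by move=> Oo lC; exists (o l) => //; exact: ClO.
have FLo o l : O o -> (forall a, a \in l -> Cl a) -> FL (o l).2.
  by move=> Oo lC; exists (o l) => //; exact: ClO.
have args n (g : 'I_n -> seq M -> M) : (forall i, FM (g i)) ->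
    exists2 l, (forall a, a \in l -> Cl a) & forall v i, @arg l v n i = g i v.
  move=> Fg; have /choice[h hP] : forall i, exists a, Cl a /\ a.1 = g i.
    by move=> i; have [a Ca ag] := Fg i; exists a.
  exists [seq h i | i <- enum 'I_n] => [a /mapP[i _ ->]|v i].
    by have [] := hP i.
  by rewrite /arg (nth_map i) ?size_enum_ord// nth_ord_enum; have [_ ->] := hP i.
have nilC a : a \in ([::] : seq A) -> Cl a by [].
have oneC a b : Cl a -> b \in [:: a] -> Cl b by move=> Ca; rewrite inE => /eqP ->.
have O1 k : O (o_coord k) by left; left; left; left; exists k.
have O2 k : O (o_u k) by left; left; left; right; exists k.
have O3 p : O (o_term p) by left; left; right; exists p.
have O4 : O o_dmap by left; right; left; left; left.
have O5 ks : O (o_re ks) by left; right; left; left; right; exists ks.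
have O6 : O o_choose by left; right; left; right.
have O7 : O o_and by left; right; right.
have O8 k : O (o_near k) by right; left; left; exists k.
have O9 p : LQ p -> O (o_atom p) by move=> Lp; right; left; right; exists p.
have O10 p : LQ p -> O (o_wit p) by move=> Lp; right; right; exists p.
exists FM, FL; split; [exact: countable_image|exact: countable_image|split].
- by move=> k; exact: (FMo _ [::] (O1 k)).
- by move=> k; exact: (FMo _ [::] (O2 k)).
- move=> n t g /args[l lC lg].
  suff <- : (o_term (existT _ n t) l).1 = (fun v => teval (fun i => g i v) t).
    exact: FMo.
  by apply/funext => v /=; congr teval; apply/funext => i; rewrite lg.
- move=> n phi g q Lphi /args[l lC lg].
  exists (o_wit (existT _ n (Sup phi), q) l).1; first by apply: FMo => //; exact: O10.
  move=> v; have -> : (fun i => g i v) = @arg l v n by apply/funext => i; rewrite lg.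
  exact: (@xgetPex _ x0 [set z | ratr q < feval phi (scons z (@arg l v n))]).
- by move=> _ [a Ca <-]; apply: (FMo _ [:: a] O4) => b; exact: oneC.
- by move=> _ ks [a Ca <-]; apply: (FMo _ [:: a] (O5 ks)) => b; exact: oneC.
- by move=> _ ks [a Ca <-]; apply: (FLo _ [:: a] (O5 ks)) => b; exact: oneC.
(* The constant [top] is the filler component of the coordinate operation. *)
- exact: (FLo _ [::] (O1 0%N)).
- move=> _ _ [a Ca <-] [b Cb <-]; exists (o_choose [:: a; b]).2.
    by apply: FLo => // c; rewrite !inE => /orP[] /eqP ->.
  move=> v; exact: (@xgetPex _ top [set c |
    large Lam A0 [set x | a.2 (rcons v x) = top /\ b.2 (rcons v x) = c]]).
- move=> _ _ _ [a Ca <-] [b Cb <-] [c Cc <-]; exists (o_and [:: a; b; c]).2.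
    by apply: FLo => // d; rewrite !inE => /or3P[] /eqP ->.
  by move=> v /=; case: asboolP => // ?; split=> // /esym.
- move=> k _ [a Ca <-]; exists (o_near k [:: a]).2.
    by apply: FLo => // b; exact: oneC.
  move=> v; exact: (@xgetPex _ top [set c | mdist (a.1 v) (dmap c) < k.+1%:R^-1]).
- move=> n phi g q Lphi /args[l lC lg].
  exists (o_atom (existT _ n phi, q) l).2; first by apply: FLo => //; exact: O9.
  move=> v /=; have -> : (fun i => g i v) = @arg l v n by apply/funext => i; rewrite lg.
  by case: ifPn => // ?; split=> // /esym.
- move=> n phi g q Lphi /args[l lC lg].
  exists (o_wit (existT _ n (CSup phi), q) l).2; first by apply: FLo => //; exact: O10.
  move=> v; have -> : (fun i => g i v) = @arg l v n by apply/funext => i; rewrite lg.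
  move=> [k kq]; apply: (@xgetPex _ top [set c | exists k, c = inj k /\
    ratr q < feval (phi k) (@arg l v n)]).
  by exists (inj k), k.
Qed.

End Skolem.

(* The two instances of interest are [Om = K -> M], with [V] the restrictions to
   finite sequences from [J], which yields [N], and [Om = unit], with [V] the empty
   sequence, which yields [M0]. *)
Section RichPower.
Variables (R : realType) (S : signature) (M : structure R S).
Variables (L : forall n, set (formula S n)) (Lam : choiceType).
Variables (x0 : M) (u : nat -> M) (A0 : set M).
Variables (top bot : Lam) (inj : nat -> Lam) (dmap : Lam -> M).
Variables (FM : set (seq M -> M)) (FL : set (seq M -> Lam)).
Hypothesis L_closed : subformula_closed L.
Hypothesis inj_inj : injective inj.
Hypothesis FMLrich : rich L x0 u A0 top inj dmap FM FL.

Context (Om : Type) (F : set_system Om) {FF : ProperFilter F}.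
Variable V : set (Om -> seq M).
Hypothesis V0 : V !=set0.
Hypothesis V_dir : forall v w, V v -> V w -> exists2 z, V z &
  exists ks ks' : seq nat, forall s,
    v s = [seq nth x0 (z s) k | k <- ks] /\ w s = [seq nth x0 (z s) k | k <- ks'].
Hypothesis V_const : forall nu v, FL nu -> V v ->
  exists2 mu, FL mu & F [set s | nu (v s) = mu [::]].

Definition instances : set (Om -> M) :=
  [set x | exists f v, [/\ FM f, V v & x = fun s => f (v s)]].

(** Since [V] is directed and the family [FM] is closed under reindexing, finitely many instances
    can be rewritten one by one over a common list of coordinates. *)
Lemma instances_common n (x : 'I_n -> Om -> M) : (forall i, instances (x i)) ->
  exists v g, [/\ V v, forall i, FM (g i) & x = fun i s => g i (v s)].
Proof.
move=> xI; suff [v Vv /choice[g gP]] : exists2 v, V v & forall i,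
    exists f, FM f /\ x i = fun s => f (v s).
  exists v, g; split=> // [i|]; first by have [] := gP i.
  by apply/funext => i; have [_ ->] := gP i.
suff [v Vv vP] : exists2 v, V v & forall i, i \in enum 'I_n ->
    exists f, FM f /\ x i = fun s => f (v s).
  by exists v => // i; apply: vP; rewrite mem_enum.
elim: (enum _) => [|i l [v Vv vP]]; first by have [v Vv] := V0; exists v.
have [f [w [Ff Vw xi]]] := xI i.
have [z Vz [ks [ks' zP]]] := V_dir Vv Vw.
exists z => // j; rewrite inE => /orP[/eqP ->|/vP[g [Fg xj]]].
  exists (fun r => f [seq nth x0 r k | k <- ks']); split.
    exact: (rich_reM FMLrich).
  by rewrite xi; apply/funext => s; have [_ ->] := zP s.
exists (fun r => g [seq nth x0 r k | k <- ks]); split.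
  exact: (rich_reM FMLrich).
by rewrite xj; apply/funext => s; have [-> _] := zP s.
Qed.

Lemma rich_power : exists (N : structure R S) (cls : (Om -> M) -> N),
  (forall b, exists2 x, instances x & cls x = b) /\
  forall n (phi : formula S n) (x : 'I_n -> Om -> M),
    L phi -> (forall i, instances (x i)) ->
    tends F (fun s => feval phi (fun i => x i s)) (feval phi (fun i => cls (x i))).
Proof.
apply: generic_power => //.
- have [v Vv] := V0; exists (fun s => nth x0 (v s) 0), (fun r => nth x0 r 0), v.
  by split=> //; exact: (rich_coord FMLrich).
- move=> n t x /instances_common[v [g [Vv Fg ->]]].
  exists (fun r => teval (fun i => g i r) t), v.
  by split=> //; exact: (rich_term FMLrich).
- move=> n phi x q Lphi /instances_common[v [g [Vv Fg ->]]].
  have [y Fy yP] := rich_sup FMLrich q Lphi Fg.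
  by exists (fun s => y (v s)) => [|s]; [exists y, v|exact: yP].
- move=> n phi x q Lphi /instances_common[v [g [Vv Fg ->]]].
  have [nu Fnu nuP] := rich_atom FMLrich q Lphi Fg.
  have [mu Fmu munu] := V_const Fnu Vv.
  (* The code [nu] of the condition is constant almost everywhere, so the condition holds almost
     everywhere or fails almost everywhere. *)
  have [mt|mt] := pselect (mu [::] = top); [left|right];
    apply: filterS munu => s /= ns.
    by apply/nuP; rewrite ns.
  by move=> /nuP; rewrite ns.
- move=> n phi x q Lphi /instances_common[v [g [Vv Fg ->]]] Fk.
  have [nu Fnu nuP] := rich_csup FMLrich q Lphi Fg.
  have [mu Fmu munu] := V_const Fnu Vv.
  (* Any good [s0] reveals the index [k] of the selected disjunct. As [nu] is constant almost
     everywhere and [inj] is injective, the same [k] is selected at almost all [s]. *)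
  have [s0 [/= s0k s0mu]] := filter_ex (filterI Fk munu).
  have [k [nuk kq]] := nuP _ s0k; exists k.
  apply: filterS (filterI Fk munu) => s [/= sk smu].
  have [k' [nuk' kq']] := nuP _ sk.
  suff -> : k = k' by [].
  by apply: inj_inj; rewrite -nuk -nuk' s0mu smu.
Qed.

End RichPower.

(** * Elementary inclusions, separated sets and two-valued predicates *)

Section Elementary.
Variables (R : realType) (S : signature) (M N : structure R S).
Variables (L : forall n, set (formula S n)) (h : N -> M).
Hypothesis hL : forall n (phi : formula S n) (a : 'I_n -> N),
  L phi -> feval phi a = feval phi (h \o a).

(** Atomic formulas suffice for the substructure part: a constant or a function value is
    characterized by having distance 0 from a variable. *)
Lemma L_elementary_sub (L0 : forall n, set (formula S n)) :
  subformula_closed L -> (forall n, @L0 n `<=` @L n) -> L_elementary L0 h.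
Proof.
move=> Lc L0L; split; last by move=> n phi a /L0L; exact: hL.
split.
- move=> x y; have := hL (scons x (fun=> y))
    (sfc_dist Lc (Var S ord0) (Var S (lift ord0 (@ord0 0)))).
  by rewrite /= scons0 sconsS.
- move=> c; have := hL (fun i : 'I_1 => const_int N c)
    (sfc_dist Lc (Var S (@ord0 0)) (Const 1 c)).
  by rewrite /= mdistxx => /esym/mdist_positivity.
- move=> f a; have := hL (scons (fun_int a) a)
    (sfc_dist Lc (Var S ord0) (App (fun i => Var S (lift ord0 i)))).
  rewrite /= scons0; under eq_fun do rewrite sconsS; rewrite mdistxx.
  move=> /esym/mdist_positivity ->; congr fun_int.
  by apply/funext => i; rewrite /= sconsS.
- move=> P a; have := hL a (sfc_pred Lc (fun i => Var S i)).
  by [].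
Qed.

End Elementary.

Lemma closure_mdist (R : realType) (X : metricType R) (D : set X) (x : X) :
  closure D x <-> forall e : R, 0 < e -> exists2 y, D y & mdist x y < e.
Proof.
split=> [Dx e e0|Dx B /nbhs_ballP[e /= e0 eB]].
  have [y [Dy]] := Dx _ (nbhsx_ballx x _ e0).
  by rewrite ballEmdist/=; exists y.
have [y Dy xy] := Dx _ e0; exists y; split=> //.
by apply: eB; rewrite ballEmdist.
Qed.

Lemma dense_in_finite (R : realType) (X : metricType R) (D A : set X) :
  finite_set D -> dense_in D A -> A `<=` D.
Proof.
move=> Dfin [_ AD]; apply: subset_trans AD _.
have Xacc : accessible_space X by apply: hausdorff_accessible; exact: metric_hausdorff.
have /closure_id <- // : closed D by move/accessible_finite_set_closed: Xacc; exact.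
Qed.

Lemma inv_succ_lt (R : realType) (e : R) : 0 < e -> exists n, n.+1%:R^-1 < e.
Proof.
by move=> e0; exists (Num.truncn e^-1); rewrite invf_plt ?posrE//; exact: truncnS_gt.
Qed.

(** By Zorn's lemma there is, for each [n], a maximal set separated by the distance [d n], and
    maximality makes it a net of the same mesh. If all of these sets embedded in [Lam], so would
    their union, which is dense. *)
Lemma separated_set (R : realType) (X : metricType R) (Lam : Type) :
  [set: nat] #<= [set: Lam] ->
  (forall D : set X, dense_in D setT -> ~ (D #<= [set: Lam])) ->
  exists (A : set X) (d : R), [/\ 0 < d, ~ (A #<= [set: Lam]) &
    forall x y, A x -> A y -> x <> y -> d <= mdist x y].
Proof.
move=> Linf Xbig.
pose d n : R := n.+1%:R^-1.
have d0 n : 0 < d n by rewrite invr_gt0.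
have /choice[A AP] : forall n, exists A : set X,
    (forall x y, A x -> A y -> x <> y -> d n <= mdist x y) /\
    (forall x, exists2 y, A y & mdist x y < d n).
  move=> n; pose P (A : set X) := forall x y, A x -> A y -> x <> y -> d n <= mdist x y.
  have [C CP totC|A [PA Amax]] := @Zorn_bigcup _ P.
    move=> x y [B CB Bx] [B' CB' By'] xy.
    by have [BB'|B'B] := totC _ _ CB CB'; [apply: (CP _ CB') => //; exact: BB'|
      apply: (CP _ CB) => //; exact: B'B].
  exists A; split=> // x; apply: contrapT => nx.
  have nA y : A y -> d n <= mdist x y.
    by move=> Ay; rewrite leNgt; apply/negP => xy; apply: nx; exists y.
  apply: (Amax (A `|` [set x])).
    split; first by move=> y; left.
    move=> /(_ x (or_intror erefl))/nA; rewrite mdistxx.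
    by have := d0 n; lra.
  move=> y z [Ay|->] [Az|->] yz //; first exact: PA.
    by rewrite metric_sym; exact: nA.
  exact: nA.
apply: contrapT => nA; pose D := \bigcup_n A n.
apply: (Xbig D).
  split=> // x _; apply/closure_mdist => e e0.
  have [n ne] := inv_succ_lt e0.
  have [_ /(_ x)[y Ay xy]] := AP n; exists y; [by exists n|exact: lt_trans ne].
have AL n : A n #<= [set: Lam].
  apply: contrapT => An; apply: nA; exists (A n), (d n); split=> //.
  by have [] := AP n.
have [l0 _] := infinite_neq0 Linf.
have /choice[f fP] : forall n, exists f : X -> Lam,
    forall x y, A n x -> A n y -> f x = f y -> x = y.
  by move=> n; have [f [_ fi]] := card_le_funP l0 (AL n); exists f.
have /choice[g gP] : forall x, exists n, D x -> A n x.
  by move=> x; have [[n _ Anx]|nD] := pselect (D x); [exists n|exists 0%N].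
apply: card_le_trans (card_square Linf).
apply: (@card_le_trans _ _ _ ([set: nat] `*` [set: Lam])).
  apply: (@card_le_fun _ _ _ _ (fun x => (g x, f (g x) x))) => //.
  move=> x y Dx Dy [gxy]; rewrite gxy; apply: fP; last exact: gP.
  by rewrite -gxy; exact: gP.
by rewrite -setXTT; apply: card_leX Linf (card_lexx _).
Qed.

(** A universal sentence of value 1 makes the negation of its matrix vanish everywhere. The matrix
    is the maximum of [r] and [1 - r], for [r] the value of the predicate, and this is 1 only at the
    endpoints. *)
Lemma pred_two_valued (R : realType) (S : signature) (M : structure R S)
    (U : pred_sym S) :
  sentence_value M (All (Or (pred_var0 U) (Neg (pred_var0 U)))) = 1 ->
  forall a : M, @pred_int R S M U (fun=> a) = 1 \/ @pred_int R S M U (fun=> a) = 0.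
Proof.
rewrite /sentence_value; set phi := Or _ _ => H a.
have le1 : feval (Neg phi) (scons a (tnth [tuple])) <= 0.
  apply: (@le_trans _ _ (feval (Sup (Neg phi)) (tnth [tuple] : 'I_0 -> M))).
    apply: ub_le_sup; last by exists a.
    by exists 1 => _ [x _ <-]; rewrite /= ge_min lexx orbT.
  have : Num.min (1 - feval (Sup (Neg phi)) (tnth [tuple] : 'I_0 -> M) +
    ratr (sval Defs.rat0)) 1 = 1 := H.
  rewrite /= rmorph0; set X := sup _.
  by case: (lerP (1 - X + 0) 1) => ? ?; lra.
move: le1; rewrite /= scons0 rmorph0.
move: (pred_int_itv (fun=> a) : 0 <= @pred_int R S M U _ <= 1).
move: (@pred_int R S M U (fun=> a)) => r /andP[r0 r1].
have -> : Num.min (1 - r + 0) 1 = 1 - r by rewrite addr0 min_l//; lra.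
have minl (x : R) : x <= 1 -> Num.min x 1 = x by move=> x1; rewrite min_l.
case: (lerP (1 - r + (1 - r)) 1) => ?.
  rewrite (minl (1 - (1 - r + (1 - r)) + (1 - r))); last by lra.
  by rewrite minl; [move=> ?; left|]; lra.
rewrite (minl (1 - 1 + (1 - r))); last by lra.
by rewrite minl; [move=> ?; right|]; lra.
Qed.

(** * Limits of truth values, and the two structures *)

Section Los.
Variables (R : realType) (S : signature) (M N : structure R S).
Context (Om : Type) (F : set_system Om) {FF : ProperFilter F}.
Variables (E : set (Om -> M)) (L : forall n, set (formula S n)).
Variable cls : (Om -> M) -> N.
Hypothesis L_closed : subformula_closed L.
Hypothesis los : forall n (phi : formula S n) (x : 'I_n -> Om -> M),
  L phi -> (forall i, E (x i)) ->
  tends F (fun s => feval phi (fun i => x i s)) (feval phi (fun i => cls (x i))).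

Lemma tends_dist x y : E x -> E y ->
  tends F (fun s => mdist (x s) (y s)) (mdist (cls x) (cls y)).
Proof.
move=> Ex Ey; have := @los 2 (Dist (Var S ord0) (Var S (lift ord0 ord0)))
  (scons x (fun=> y)) (sfc_dist L_closed _ _).
rewrite /= scons0 sconsS; apply=> i.
by have [j ->|->] := unliftP ord0 i; rewrite ?sconsS ?scons0.
Qed.

Lemma tends_pred U x : E x ->
  tends F (fun s => @pred_int R S M U (fun=> x s)) (@pred_int R S N U (fun=> cls x)).
Proof.
by move=> Ex; have := @los 1 (pred_var0 U) (fun=> x) (sfc_pred L_closed _); apply.
Qed.

Lemma los_sentence (x : Om -> M) sigma :
  L sigma -> sentence_value N sigma = sentence_value M sigma.
Proof.
move=> Ls; have := @los 0 sigma (fun=> x) Ls (ltac:(by case)).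
have -> : (fun _ : 'I_0 => cls x) = tnth [tuple] by apply/funext => -[].
have -> : (fun s => feval sigma (fun _ : 'I_0 => x s)) =
    fun=> feval sigma (tnth [tuple] : 'I_0 -> M).
  by apply/funext => s; congr feval; apply/funext => -[].
by move=> H; exact: (tends_unique H (@tends_cst _ _ F _ _)).
Qed.

End Los.

Theorem theorem5p3 (R : realType) (S : signature)
    (U : pred_sym S) (U_unary : pred_arity U = 1%N)
    (L : forall n : nat, set (formula S n)) (L_cfrag : countable_fragment L)
    (T : set (formula S 0)) (T_L : T `<=` L 0%N)
    (T_U : entails R T (All (Or (pred_var0 U) (Neg (pred_var0 U)))))
    (M : structure R S) (M_T : models M T)
    (kappa lambda : Type)
    (lambda_infinite : [set: nat] #<= [set: lambda])
    (lambda_lt_kappa : [set: lambda] #<= [set: kappa] /\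
                       ~ ([set: kappa] #<= [set: lambda]))
    (M_type : of_type U M kappa lambda) :
  exists N : structure R S,
    [/\ models N T,
        L_equiv L N M,
        (exists2 aleph1 : Type, is_aleph1 aleph1 & of_type U N aleph1 nat) &
        exists (M0 : structure R S) (i : M0 -> M) (j : M0 -> N),
          [/\ models M0 T,
              L_elementary L i,
              L_elementary L j &
              dense_in (j @` true_set U M0) (true_set U N)]].
Proof.
have [L' [LL' L'c L'cnt]] := countable_subformulas L_cfrag.
have [[_ kmin] [[D [DV VD] /card_eqPle[Dl lD]] _]] := M_type.
have [_ nkl] := lambda_lt_kappa.
pose Lam : choiceType := {classic lambda}.
have Linf : [set: nat] #<= [set: Lam] := lambda_infinite.
have [l0 _] := infinite_neq0 Linf.
have nD : [set: nat] #<= D := card_le_trans lambda_infinite lD.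
have D0 := infinite_neq0 nD.
have [x0 _] := D0.
(* [dmap] enumerates by [Lam] a dense part [D] of the true set, and [u] lists infinitely many
   distinct points of it, which will make the true set of [M0] infinite. *)
have [dmap [dmapD Ddmap]] := @card_le_surjP _ Lam l0 D D0 Dl.
have [u [uD u_inj]] := card_le_funP x0 nD.
have [inj [_ inj_inj']] := card_le_funP l0 Linf.
have inj_inj : injective inj by move=> m n; exact: inj_inj'.
have pU := pred_two_valued (T_U M M_T).
(* A dense subset of [M] that embeds in [lambda] would make [kappa] embed in [lambda]. *)
have [|A0 [d [d0 A0big A0sep]]] := @separated_set R M Lam Linf.
  by move=> D' D'd D'l; apply: nkl; exact: card_le_trans (kmin _ D'd) D'l.
have top_bot : inj 0%N <> inj 1%N by move=> /inj_inj.
have [FM [FL [FMc FLc rFL]]] :=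
  exists_rich x0 u A0 inj dmap top_bot L'c L'cnt.
have [K0 [K0unc K0min]] := exists_aleph1.
pose K : choiceType := {classic K0}.
have [J [G [Jc gG]]] := @exists_generic M K x0 Lam A0 Linf A0big _ FL
  (rich_top rFL) (fun nu ks => @rich_reL _ _ _ _ _ _ _ _ _ _ _ _ _ rFL nu ks)
  (rich_choose rFL) (rich_and rFL) FLc K0unc.
pose F : set_system (K -> M) := filter_from G id.
have FF : ProperFilter F.
  apply: filter_from_proper; last by move=> Z; exact: (gen_neq0 gG).
  apply: filter_from_filter; first exact: (gen_ne gG).
  by move=> Z Z' GZ GZ'; exact: (gen_dir gG GZ GZ').
pose V : set ((K -> M) -> seq M) :=
  [set v | exists2 e : seq K, (forall k, k \in e -> J k) & v = fun s => map s e].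
have V0 : V !=set0 by exists (fun s => map s [::]); exists [::].
have VI e : (forall k, k \in e -> J k) -> V (fun s => map s e) by exists e.
have V_dir v w : V v -> V w -> exists2 z, V z & exists ks ks' : seq nat, forall s,
    v s = [seq nth x0 (z s) k | k <- ks] /\ w s = [seq nth x0 (z s) k | k <- ks'].
  move=> [e eJ ->] [e' e'J ->]; exists (fun s => map s (e ++ e')).
    by apply: VI => k; rewrite mem_cat => /orP[/eJ|/e'J].
  exists (map (index^~ (e ++ e')) e), (map (index^~ (e ++ e')) e') => s.
  by split; rewrite map_reindex// => k ke; rewrite mem_cat ke ?orbT.
have V_const nu v : FL nu -> V v ->
    exists2 mu, FL mu & F [set s | nu (v s) = mu [::]].
  by move=> Fnu [e eJ ->]; exact: (gen_const gG Fnu eJ).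
have [N [cls [cls_surj los]]] :=
  @rich_power R S M L' Lam x0 u A0 _ inj dmap FM FL L'c inj_inj rFL _ F FF
    V V0 V_dir V_const.
pose IN := instances FM V.
(* Limits along a principal filter are values, so this second power is a copy of the countable
   Skolem hull in [M] formed by the values [f [::]]. *)
pose F1 : set_system unit := principal_filter tt.
have FF1 : ProperFilter F1 by exact: principal_filter_proper.
pose V1 : set (unit -> seq M) := [set fun=> [::]].
have V1_dir v w : V1 v -> V1 w -> exists2 z, V1 z & exists ks ks' : seq nat, forall s,
    v s = [seq nth x0 (z s) k | k <- ks] /\ w s = [seq nth x0 (z s) k | k <- ks'].
  by move=> -> ->; exists (fun=> [::]) => //; exists [::], [::].
have V1_const nu v : FL nu -> V1 v ->
    exists2 mu, FL mu & F1 [set s | nu (v s) = mu [::]].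
  by move=> Fnu ->; exists nu => //; apply: nearW.
have V10 : V1 !=set0 by exists (fun=> [::]).
have [M0 [cls1 [cls1_surj los1]]] :=
  @rich_power R S M L' Lam x0 u A0 _ inj dmap FM FL L'c inj_inj rFL _ F1 FF1
    V1 V10 V1_dir V1_const.
have cls1_ex (b : M0) : exists f, FM f /\ b = cls1 (fun=> f [::]).
  by have [_ [f [v [Ff -> ->]]] <-] := cls1_surj b; exists f.
have [r rP] := choice cls1_ex.
have rFM b : FM (r b) by have [] := rP b.
have rcls b : b = cls1 (fun=> r b [::]) by have [] := rP b.
have V1nil : V1 (fun=> [::]) by [].
have I1 f : FM f -> instances FM V1 (fun=> f [::]) by move=> Ff; exists f, (fun=> [::]).
have IN0 f : FM f -> IN (fun=> f [::]).
  by move=> Ff; exists f, (fun s => map s [::]); split=> //; exact: VI.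
pose i (b : M0) : M := r b [::].
pose j (b : M0) : N := cls (fun=> i b).
have iL n (phi : formula S n) (a : 'I_n -> M0) :
    L' n phi -> feval phi a = feval phi (i \o a).
  move=> Lphi.
  have := los1 n phi (fun k => fun=> i (a k)) Lphi (fun k => I1 _ (rFM (a k))).
  have -> : (fun k => cls1 (fun=> i (a k))) = a by apply/funext => k; rewrite -rcls.
  by move=> H; exact: (tends_unique H (@tends_cst _ _ F1 _ _)).
have jL n (phi : formula S n) (a : 'I_n -> M0) :
    L' n phi -> feval phi a = feval phi (j \o a).
  move=> Lphi; rewrite iL//.
  have := los n phi (fun k => fun=> i (a k)) Lphi (fun k => IN0 _ (rFM (a k))).
  by move=> H; exact: (tends_unique (@tends_cst _ _ F _ _) H).
have i_elem := L_elementary_sub iL L'c (fun n => @LL' n).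
have j_elem := L_elementary_sub jL L'c (fun n => @LL' n).
have [[idist _ _ ipred] _] := i_elem.
have [[jdist _ _ jpred] _] := j_elem.
have ionto f : FM f -> exists m, i m = f [::].
  move=> Ff; exists (cls1 (fun=> f [::])); apply: mdist_positivity.
  have := tends_dist L'c los1 (I1 _ (rFM (cls1 (fun=> f [::])))) (I1 _ Ff).
  by rewrite -rcls mdistxx => H; exact: (tends_unique (@tends_cst _ _ F1 _ _) H).
have NM sigma : L' 0%N sigma -> sentence_value N sigma = sentence_value M sigma.
  exact: (los_sentence los (fun=> x0)).
have M0M sigma : L' 0%N sigma -> sentence_value M0 sigma = sentence_value M sigma.
  exact: (los_sentence los1 (fun=> x0)).
have jV : dense_in (j @` true_set U M0) (true_set U N).
  split=> [_ [b bU <-]|b bU]; first by rewrite /true_set/= -bU -jpred.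
  apply/closure_mdist => e e0.
  have [k ke] := inv_succ_lt e0.
  have [x INx xb] := cls_surj b; have [f [v [Ff Vv xE]]] := INx.
  have UF : F [set s | @pred_int R S M U (fun=> f (v s)) = 1].
    have := tends_pred L'c los U INx; rewrite xb xE.
    (* Having limit 1, the predicate exceeds 1/2 almost everywhere in [M], where it is two-valued
       and hence equal to 1. *)
    have half : (2^-1 : R) < 1 by lra.
    rewrite (_ : pred_int (fun=> b) = 1)// => /tends_gt/(_ half).
    apply: filterS => s /=.
    by case: (pU (f (v s))) => -> //; rewrite ltNge invr_ge0 ler0n.
  (* [nu] selects the index of a point of [D] close to [f (v s)]. It is constant almost everywhere,
     so the single point [dmap (mu [::])], which comes from [M0], is close for almost all [s]. *)
  have [nu Fnu nuP] := rich_near rFL k Ff.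
  have [mu Fmu munu] := V_const _ _ Fnu Vv.
  have Fc : FM (fun w => dmap (mu w)) := rich_dmap rFL Fmu.
  have [m im] := ionto _ Fc.
  exists (j m).
    exists m => //; rewrite /true_set/= -ipred.
    by have := DV _ (dmapD (mu [::])); rewrite -im.
  apply: le_lt_trans ke; rewrite -xb.
  apply: (tends_le (tends_dist L'c los INx (IN0 _ (rFM m))) (@tends_cst _ _ F _ _)).
  apply: filterS (filterI UF munu) => s [/= /VD/closure_mdist fs ms].
  have [|c Dc fc] := fs k.+1%:R^-1; first by rewrite invr_gt0.
  have [l _ lc] := Ddmap _ Dc.
  rewrite xE -/(i m) im -ms; apply/ltW/nuP.
  by exists l; rewrite lc.
have tJ k : J k -> IN (fun s => s k).
  move=> Jk; exists (fun v => nth x0 v 0), (fun s => map s [:: k]).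
  split=> //; first exact: (rich_coord rFL).
  by apply: VI => k'; rewrite inE => /eqP ->.
have sepJ k k' : J k -> J k' -> k <> k' ->
    d <= mdist (cls (fun s => s k)) (cls (fun s => s k')).
  move=> Jk Jk' kk'.
  apply: (tends_le (@tends_cst _ _ F _ d) (tends_dist L'c los (tJ _ Jk) (tJ _ Jk'))).
  apply: filterS (filterI (filterI (gen_A0 gG Jk) (gen_A0 gG Jk'))
    (gen_inj gG Jk Jk' kk')).
  by move=> s [[/= ? ?] ?]; exact: A0sep.
(* The uncountable set [J] is at least as large as [K0], by minimality of aleph_1. *)
have KJ : [set: K0] #<= J.
  rewrite -(card_le_eqr (card_setT J)); apply: K0min.
  by rewrite (eq_countable (card_setT _)).
(* Two coordinates approximated within [d / 2] by the same point of [D'] would be less than [d]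
   apart. *)
have Kdense (D' : set N) : dense_in D' setT -> [set: K0] #<= D'.
  move=> [_ D'd]; apply: card_le_trans KJ _.
  have /choice[f fP] : forall k, exists y,
      J k -> D' y /\ mdist (cls (fun s => s k)) y < d / 2.
    move=> k; have /closure_mdist/(_ (d / 2))[|y D'y ky] := D'd (cls (fun s => s k)) I.
      by lra.
    by exists y.
  apply: (@card_le_fun _ _ _ _ f) => [k /fP[]//|k k' Jk Jk' fkk'].
  apply: contrapT => kk'; have := sepJ _ _ Jk Jk' kk'.
  have [_ fk] := fP _ Jk; have [_ fk'] := fP _ Jk'.
  have := metric_triangle (cls (fun s => s k)) (f k) (cls (fun s => s k')).
  by rewrite {2}fkk' [mdist (f k') _]metric_sym; lra.
have K0inf : [set: nat] #<= [set: K0].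
  by apply/infiniteP => /finite_set_countable.
have FM0 : FM !=set0 by exists (fun=> u 0%N); exact: (rich_u rFL).
have [fe [feF Ffe]] := card_le_surjP 0%N FM0 FMc.
(* An element of [N] is given by the index of a function of the countable family and a finite list
   of coordinates. *)
have NK : [set: N] #<= [set: K0].
  apply: (@card_le_trans _ _ _ ([set: nat] `*` [set: seq K0])).
    apply: (@card_le_surj _ _ _ _
      (fun p => cls (fun s => fe p.1 (map s (p.2 : seq K))))).
    move=> b _; have [_ [f [_ [Ff [e _ ->] ->]]] <-] := cls_surj b.
    by have [n _ <-] := Ffe _ Ff; exists (n, e).
  apply: card_le_trans (card_square K0inf).
  by rewrite -setXTT; apply: card_leX K0inf (card_le_seq K0inf).
have jVnat : j @` true_set U M0 #= [set: nat].
  apply/card_eqPle; split.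
    apply: sub_countable (card_image_le _ _) _; apply: sub_countable (card_leT _) _.
    apply: (@card_le_surj _ _ _ _ (fun n => cls1 (fun=> fe n [::]))) => b _.
    by rewrite (rcls b); have [n _ <-] := Ffe _ (rFM b); exists n.
  (* The distinct points [u n] of the true set of [M] come from [M0], so the true set of [M0] is
     infinite. *)
  have /choice[m mP] : forall n, exists m, i m = u n.
    by move=> n; exact: (ionto _ (rich_u rFL n)).
  apply: (@card_le_fun _ _ _ _ (fun n => j (m n))) => [n _|n n' _ _ jm].
    exists (m n) => //; rewrite /true_set/= -ipred.
    by have := DV _ (uD n I); rewrite -mP.
  apply: u_inj => //; rewrite -!mP; apply: mdist_positivity.
  by rewrite idist -jdist jm mdistxx.
exists N; split.
- by move=> sigma Ts; rewrite NM ?M_T//; exact/LL'/T_L.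
- by move=> sigma Ls; exact/NM/LL'.
- exists K0; first by split.
  split; split=> //.
  + exists [set: N]; first by split=> //; exact: subset_closure.
    by apply/card_eqPle; split=> //; apply: Kdense; split=> //; exact: subset_closure.
  + by exists (j @` true_set U M0).
  (* A finite set dense in the true set of [N] would contain it, although that set includes the
     infinite image of the true set of [M0]. *)
  + move=> D' D'd; apply/infiniteP => D'fin.
    have /infiniteP : [set: nat] #<= j @` true_set U M0.
      by have /card_eqPle[] := jVnat.
    apply; have WD' := dense_in_finite D'fin D'd; have [VW _] := jV.
    exact: sub_finite_set (subset_trans VW WD') D'fin.
- exists M0, i, j; split=> //.
  by move=> sigma Ts; rewrite M0M ?M_T//; exact/LL'/T_L.
Qed.
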